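(* Let $\{J_\omega\}_{\omega\in\Omega}$ be a family of ergodic Jacobi operators with Jacobi parameters $\{a_n(\omega),b_n(\omega)\}_n$, and let $\Sigma$ be its (almost sure) spectrum. Let $\lambda_m:=\min_{E\in\Sigma}E$ and $\lambda_M:=\max_{E\in\Sigma}E$, and let $I(\nu)$ denote the logarithmic energy of a measure $\nu$. Then $$\lambda_M-\lambda_m\ge 4\exp(-I(dN)),$$ where $dN$ is the density of states measure of the family. Equivalently, $$\lambda_M-\lambda_m\ge 4A\exp\Big(\int L(E)\,dN(E)\Big),$$ where $A:=\lim_{n\to\infty}(a_1(\omega)\cdots a_n(\omega))^{1/n}$ for $\mu$-a.e. $\omega$ and $L$ is the Lyapunov exponent of $J_\omega$.
   Context: Setting. $(\Omega,\mu)$ is a probability measure space and $T:\Omega\to\Omega$ is an ergodic (measure-preserving) transformation. $f,g:\Omega\to\mathbb{R}$ are measurable functions, with $f$ positive, bounded and invertible (i.e. $1/f$ bounded), and $g$ bounded. For $\omega\in\Omega$ and $n\in\mathbb{N}=\{1,2,\dots\}$ put $a_n(\omega)=f(T^n\omega)$ and $b_n(\omega)=g(T^n\omega)$. The Jacobi operator $J_\omega$ is the self-adjoint operator on $\ell^2(\mathbb{N})$ given by $$(J_\omega\psi)_n=a_{n-1}(\omega)\psi_{n-1}+b_n(\omega)\psi_n+a_n(\omega)\psi_{n+1},\qquad n\in\mathbb{N},$$ with the convention $a_0=0$. The family $\{J_\omega\}_{\omega\in\Omega}$ is called an ergodic family of Jacobi operators with parameters $\{a_n(\omega),b_n(\omega)\}_n$.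 Spectrum. $\Sigma\subset\mathbb{R}$ denotes the compact set, independent of $\omega$, such that $\sigma(J_\omega)=\Sigma$ for $\mu$-a.e. $\omega$; it is called the spectrum of $J_\omega$. Lyapunov exponent. For $z\in\mathbb{C}$ set $$A_z(\omega)=\frac{1}{f(T\omega)}\begin{pmatrix} z-g(T\omega) & -f(\omega)\\ f(T\omega) & 0\end{pmatrix},\qquad A_z^n(\omega)=A_z(T^{n-1}\omega)\cdots A_z(T\omega)A_z(\omega),\quad n\ge1.$$ These are the transfer matrices: solutions of $a_{n-1}(\omega)\psi_{n-1}+b_n(\omega)\psi_n+a_n(\omega)\psi_{n+1}=z\psi_n$, $n\ge1$, with $a_0=0$, satisfy $(\psi_{n+1},\psi_n)^{T}=A_z^n(\omega)(\psi_1,\psi_0)^{T}$ with $\psi_0=0$. The Lyapunov exponent $L(z)\in[0,\infty)$ is the number satisfying, for $\mu$-a.e. $\omega$, $$L(z)=\inf_{n\ge1}\frac1n\int_\Omega\log\|A_z^n\|\,d\mu=\lim_{n\to\infty}\frac1n\int_\Omega\log\|A_z^n\|\,d\mu=\lim_{n\to\infty}\frac1n\log\|A_z^n(\omega)\|.$$ Density of states measure. $dN$ is the measure defined by $$\int h\,dN=\int_\Omega\langle\delta_0,h(J_\omega)\delta_0\rangle\,d\mu(\omega)$$ for bounded measurable $h$, where $\delta_0$ is the standard basis vector at site $0$. It is a probability measure supported on $\Sigma$, and it is related to $L$ by the Thouless formula $L(z)=\int\log|E-z|\,dN(E)-\log A$ for every $z\in\mathbb{C}$ (which determines $dN$ from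 $L$ and $A$). Logarithmic energy. For a finite Borel measure $\nu$ supported on a compact subset of $\mathbb{C}$, $$I(\nu):=\int\int\log\frac{1}{|z-w|}\,d\nu(w)\,d\nu(z)\in(-\infty,\infty].$$
   Formalization: Since ℓ²({1,2,…}) has no site 0, and the first basis vector would contradict the Thouless formula (a=1, b=0), dN is defined with the whole-line Jacobi operator on ℓ²(ℤ), whose coefficients are a two-sided stationary version of (a_n, b_n). *)

(* Defs.v *)
From HB Require Import structures.
From mathcomp Require Export all_boot all_order all_algebra.
From mathcomp.real_closed Require Export complex.
From mathcomp Require Export all_classical all_reals all_analysis.
Export numFieldNormedType.Exports.

Set Implicit Arguments.
Unset Strict Implicit.
Unset Printing Implicit Defensive.

Import Order.TTheory GRing.Theory Num.Theory.

Local Open Scope classical_set_scope.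
Local Open Scope complex_scope.
Local Open Scope ring_scope.

(** ** Ergodic transformations *)

Definition measure_preserving (R : realType) (d : measure_display)
    (Omega : measurableType d) (mu : probability Omega R)
    (T : Omega -> Omega) : Prop :=
  measurable_fun setT T /\
  forall B : set Omega, measurable B -> mu (T @^-1` B) = mu B.

Definition ergodic (R : realType) (d : measure_display)
    (Omega : measurableType d) (mu : probability Omega R)
    (T : Omega -> Omega) : Prop :=
  measure_preserving mu T /\
  forall B : set Omega, measurable B -> T @^-1` B = B ->
    mu B = 0%E \/ mu B = 1%E.

(** ** The Hilbert space l^2(I) and the spectrum of an operator on it *)

Definition l2sq (R : realType) (I : choiceType) (u : I -> R[i]) : \bar R :=
  (\esum_(i in [set: I]) (Normc.normc (u i) ^+ 2)%:E)%E.

Definition l2 (R : realType) (I : choiceType) : set (I -> R[i]) :=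
  [set u | (l2sq u < +oo)%E].

(* [z] is in the resolvent set of [H] when [H - z] maps l^2(I) onto itself and
   is bounded below, i.e. is a bijection of l^2(I) with bounded inverse. Here
   [H] is meant to map l^2(I) into itself. *)
Definition resolvent_set (R : realType) (I : choiceType)
    (H : (I -> R[i]) -> I -> R[i]) : set R[i] :=
  [set z |
    (forall v, l2 v -> exists2 u, l2 u & forall i, H u i - z * u i = v i) /\
    (exists K : R, forall u, l2 u ->
       (l2sq u <= K%:E * l2sq (fun i => H u i - z * u i)%R)%E)].

Definition spectrum (R : realType) (I : choiceType)
    (H : (I -> R[i]) -> I -> R[i]) : set R[i] :=
  ~` resolvent_set H.

(** ** Jacobi operators *)

(* Jacobi operator on l^2({1, 2, ...}): the index [n : nat] of [u] stands for
   the site [n.+1], whereas [a] and [b] are indexed by the sites themselves. The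
   convention a_0 = 0 is the first branch, so [a 0] and [b 0] are not used. *)
Definition jacobi (R : realType) (a b : nat -> R) (u : nat -> R[i]) :
    nat -> R[i] :=
  fun n => (if n is m.+1 then (a n)%:C * u m else 0)
           + (b n.+1)%:C * u n + (a n.+1)%:C * u n.+1.

(* Jacobi operator on l^2(Z). *)
Definition jacobiZ (R : realType) (a b : int -> R) (u : int -> R[i]) :
    int -> R[i] :=
  fun n => (a (n - 1))%:C * u (n - 1) + (b n)%:C * u n + (a n)%:C * u (n + 1).

Definition ergodic_jacobi (R : realType) (Omega : Type) (T : Omega -> Omega)
    (f g : Omega -> R) (w : Omega) : (nat -> R[i]) -> nat -> R[i] :=
  jacobi (fun n => f (iter n T w)) (fun n => g (iter n T w)).

(** ** Transfer matrices and Lyapunov exponent *)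

Definition enorm (R : realType) (m : nat) (v : 'cV[R[i]]_m) : R :=
  Num.sqrt (\sum_(i < m) Normc.normc (v i ord0) ^+ 2).

(* The operator norm for the Euclidean norm: the matrix norm of the library is
   the maximum of the entries, which is not submultiplicative. *)
Definition opnorm (R : realType) (m : nat) (M : 'M[R[i]]_m) : R :=
  sup [set enorm (M *m v) | v in [set v : 'cV[R[i]]_m | enorm v <= 1]].

Definition transfer (R : realType) (Omega : Type) (T : Omega -> Omega)
    (f g : Omega -> R) (z : R[i]) (w : Omega) : 'M[R[i]]_2 :=
  ((f (T w))^-1)%:C *:
    (block_mx (z - (g (T w))%:C)%:M (- (f w)%:C)%:M
              (f (T w))%:C%:M       0 : 'M[R[i]]_(1 + 1)).

Fixpoint cocycle (R : realType) (Omega : Type) (T : Omega -> Omega)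
    (f g : Omega -> R) (z : R[i]) (n : nat) (w : Omega) : 'M[R[i]]_2 :=
  if n is m.+1 then
    transfer T f g z (iter m T w) *m cocycle T f g z m w
  else 1%:M.

Definition lyapunov (R : realType) (d : measure_display)
    (Omega : measurableType d) (mu : probability Omega R)
    (T : Omega -> Omega) (f g : Omega -> R) (z : R[i]) : R :=
  inf [set n%:R^-1 * \int[mu]_w ln (opnorm (cocycle T f g z n w))
      | n in [set n : nat | (0 < n)%N]].

(** ** Density of states *)

Definition delta (R : realType) (i : int) : int -> R[i] :=
  fun j => (j == i)%:R.

(* [m] is the spectral measure of [H] at the vector [v]:
   <v, p(H) v> = \int p dm for the polynomials p, here for v = delta_0, for
   which <delta_0, u> = u 0. When [H] is a bounded self-adjoint operator such an
   [m] exists, is unique, and has compact support, since its moments grow at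
   most geometrically. For h bounded and measurable, <delta_0, h(H) delta_0> is
   then \int h dm. *)
Definition spectral_measure0 (R : realType)
    (H : (int -> R[i]) -> int -> R[i])
    (m : {measure set (measurableTypeR R) -> \bar R}) : Prop :=
  forall k : nat,
    (\int[m]_x (x ^+ k)%:E)%E = (complex.Re (iter k H (delta R 0) 0))%:E.

(* [(alpha, beta)] is a two-sided version of the stationary process
   (f o T^n, g o T^n)_{n >= 0}: on every window of integers it has the law of
   that process. When [T] is invertible one can take Omega' = Omega, and for
   [alpha n], [beta n] the compositions of f, g with the n-th power of [T] for
   n in Z; in general one exists by Kolmogorov's extension theorem. *)
Definition two_sided_version (R : realType) (d : measure_display)
    (Omega : measurableType d) (mu : probability Omega R)
    (T : Omega -> Omega) (f g : Omega -> R)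
    (d' : measure_display) (Omega' : measurableType d')
    (mu' : probability Omega' R) (alpha beta : int -> Omega' -> R) : Prop :=
  [/\ forall n, measurable_fun setT (alpha n),
      forall n, measurable_fun setT (beta n),
      exists C : R, forall n w, `|alpha n w| <= C /\ `|beta n w| <= C &
      forall (k n : nat)
        (B : set (n.-tuple (measurableTypeR R * measurableTypeR R)%type)),
        measurable B ->
        mu' [set w | B [tuple (alpha (i%:Z - k%:Z) w, beta (i%:Z - k%:Z) w)
                       | i < n]] =
        mu [set w | B [tuple (f (iter i T w), g (iter i T w)) | i < n]]].

(* \int h dN = \int <delta_0, h(J_w) delta_0> dmu'(w), for bounded measurable
   h, where J_w is the operator on l^2(Z): it is the two-sided operator that has
   a site 0, and for which the Thouless formula holds (the average of the
   spectral measures of the one-sided operator at its boundary site is in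
   general another measure). *)
Definition density_of_states (R : realType) (d : measure_display)
    (Omega : measurableType d) (mu : probability Omega R)
    (T : Omega -> Omega) (f g : Omega -> R)
    (N : {measure set (measurableTypeR R) -> \bar R}) : Prop :=
  exists (d' : measure_display) (Omega' : measurableType d')
         (mu' : probability Omega' R) (alpha beta : int -> Omega' -> R)
         (m : Omega' -> {measure set (measurableTypeR R) -> \bar R}),
    [/\ two_sided_version mu T f g mu' alpha beta,
        forall w, spectral_measure0
                    (jacobiZ (fun n => alpha n w) (fun n => beta n w)) (m w) &
        forall h : measurableTypeR R -> R,
          measurable_fun setT h -> (exists C : R, forall x, `|h x| <= C) ->
          (\int[N]_x (h x)%:E = \int[mu']_w \int[m w]_x (h x)%:E)%E].

(** ** Logarithmic energy *)

(* [lne 0 = -oo], so the kernel is [+oo] on the diagonal; [lne (1 / 0)] would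
   be [-oo] there. *)
Definition log_energy (R : realType)
    (nu : {measure set (measurableTypeR R) -> \bar R}) : \bar R :=
  (\int[nu]_x \int[nu]_y (- lne `|x - y|%R%:E))%E.

(* Main.v *)
(* On an interval of length 2 h, expanding log |x - y| in Chebyshev polynomials and
   damping the series shows that, up to an arbitrarily small constant, it is at most
   log (h / 2) - sum_n gam_n t_n(x) t_n(y) with gam_n >= 0. Integrating this twice
   against dN gives -I(dN) <= log (h / 2), once dN is known to live on the interval.

   For the Lyapunov exponent, only the inequality L(E) <= \int p dN - log A is needed,
   where p is any polynomial with log |E - x| <= p(x) on [lambda_m, lambda_M]; the right
   side of the kernel estimate, as a function of x, is such a p. Indeed, the entries of
   the transfer matrix are determinants det (E - J') of truncations J', whose eigenvalues
   lie in [lambda_m, lambda_M], so that log |det (E - J')| <= tr p(J'); up to boundary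
   terms this trace is a Birkhoff sum with mean \int p dN. *)
Require Import Defs.
From mathcomp Require Import ring lra zify measurable_realfun.
Import Order.TTheory GRing.Theory Num.Theory.

Set Implicit Arguments.
Unset Strict Implicit.
Unset Printing Implicit Defensive.

Local Open Scope classical_set_scope.
Local Open Scope complex_scope.
Local Open Scope ring_scope.

(** * The logarithmic kernel on an interval *)

(** One polynomial [q] serves both bounds. With [tau] the integral of polynomials against dN and p_E
    the polynomial in x above log |E - x|, q(E) = tau(p_E) is a polynomial in E, and tau(q) is log
    (h / 2) plus the small constant minus sum_n gam_n tau(t_n)^2. The factor 4 is due to h / 2, a
    quarter of the length of the interval. Working with polynomials reduces the problem to moments,
    and this closes a gap in the data: Sigma belongs to operators on the half-line, whereas dN comes
    from a two-sided process that shares only its finite-window laws with the orbit. A diagonal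
    entry of a k-th power sees k sites on each side, so its mean is the same in both pictures. The
    spectrum acts through bounds on the quadratic form at finitely supported vectors, which
    truncations inherit. The half-width h exceeds (lambda_M - lambda_m) / 2 by a margin, removed at
    the very end: Markov's inequality only shows that the complement of a strictly larger interval
    is null, and h > 0 must hold even when the two ends coincide. *)

Fixpoint chebyshev (R : realType) (n : nat) : {poly R} :=
  if n is m.+1 then
    if m is k.+1 then 2 *: ('X * chebyshev R m) - chebyshev R k else 'X
  else 1.
Arguments chebyshev : simpl never.

Lemma cosS (R : realType) (n : nat) (al : R) :
  cos (n.+2%:R * al) = 2 * cos al * cos (n.+1%:R * al) - cos (n%:R * al).
Proof.
have -> : n.+2%:R * al = n.+1%:R * al + al by rewrite -(natr1 n.+1) mulrDl mul1r.
have -> : n%:R * al = n.+1%:R * al - al by rewrite -(natr1 n) mulrDl mul1r addrK.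
by rewrite cosB cosD; ring.
Qed.

Lemma chebyshev_cos (R : realType) (n : nat) (al : R) :
  (chebyshev R n).[cos al] = cos (n%:R * al).
Proof.
suff [] : (chebyshev R n).[cos al] = cos (n%:R * al) /\
  (chebyshev R n.+1).[cos al] = cos (n.+1%:R * al) by [].
elim: n => [|n [IH1 IH2]].
  by rewrite mul0r mul1r cos0 /= hornerX hornerE.
split => //; rewrite cosS -IH1 -IH2.
have -> : chebyshev R n.+2 = 2 *: ('X * chebyshev R n.+1) - chebyshev R n by [].
by rewrite hornerD hornerN hornerZ hornerM hornerX; ring.
Qed.

(** This is |1 - r e^(i al)|^2, the denominator of the Poisson kernel. *)
Definition poisson_den (R : realType) (al r : R) := 1 - 2 * cos al * r + r ^+ 2.

Lemma poisson_den_ge (R : realType) (al r : R) :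
  0 <= r -> (1 - r) ^+ 2 <= poisson_den al r.
Proof. by move=> r0; rewrite /poisson_den; have := cos_le1 al; nra. Qed.

(** The recurrence [cosS] makes the product telescope. The two terms with r^N and r^(N+1) are the
    error of truncating the series of (cos al - r) / |1 - r e^(i al)|^2. *)
Lemma poisson_den_sum (R : realType) (al r : R) (N : nat) :
  poisson_den al r * (\sum_(n < N) cos (n.+1%:R * al) * r ^+ n) =
  cos al - r - r ^+ N * cos (N.+1%:R * al) + r ^+ N.+1 * cos (N%:R * al).
Proof.
elim: N => [|N IH].
  by rewrite big_ord0 mulr0 expr0 expr1 !mul1r mul0r cos0; ring.
rewrite big_ord_recr /= mulrDr IH cosS /poisson_den !exprS; ring.
Qed.

(** Partial sum of the power series in r of - log |1 - r e^(i al)|^2. *)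
Definition poisson_sum (R : realType) (al : R) (N : nat) : {poly R} :=
  \sum_(n < N) (2 * cos (n.+1%:R * al) / n.+1%:R) *: 'X^(n.+1).

Lemma deriv_poisson_sum (R : realType) (al r : R) (N : nat) :
  (poisson_sum al N)^`().[r] = 2 * \sum_(n < N) cos (n.+1%:R * al) * r ^+ n.
Proof.
rewrite /poisson_sum raddf_sum /= horner_sum mulr_sumr; apply: eq_bigr => n _.
rewrite linearZ /= derivXn hornerZ hornerMn hornerXn -mulr_natr /=.
have : (n.+1%:R : R) != 0 by rewrite pnatr_eq0.
by move=> ?; field.
Qed.

(** No convergence of series is involved: [h], the logarithm of the denominator plus the partial
    sum, vanishes at 0, and its derivative is an explicit truncation error, so the mean value
    theorem bounds [h r]. *)
Lemma poisson_den_le (R : realType) (al r : R) (N : nat) :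
  0 < r -> r < 1 ->
  poisson_den al r <=
  expR (- (poisson_sum al N).[r] + 4 * r ^+ N / (1 - r) ^+ 2).
Proof.
move=> r0 r1.
pose D : {poly R} := 1 - (2 * cos al) *: 'X + 'X^2.
have DE (x : R) : D.[x] = poisson_den al x.
  by rewrite /D /poisson_den !hornerE.
have D_gt0 (x : R) : 0 <= x -> x < 1 -> 0 < D.[x].
  move=> x0 x1; rewrite DE; apply: lt_le_trans (poisson_den_ge al x0).
  by rewrite exprn_gt0// subr_gt0.
pose h : R -> R := ((@ln R \o horner D) + horner (poisson_sum al N)).
pose dh (x : R) : R := (D.[x])^-1 * D^`().[x] + (poisson_sum al N)^`().[x].
have hd (x : R) : 0 <= x -> x < 1 -> is_derive x 1 h (dh x).
  move=> x0 x1; apply: is_deriveD; apply: is_derive1_comp.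
  by apply: is_derive1_ln; exact: D_gt0.
have dhE (x : R) : 0 <= x -> x < 1 ->
    dh x = 2 * (x ^+ N.+1 * cos (N%:R * al) - x ^+ N * cos (N.+1%:R * al)) / D.[x].
  move=> x0 x1; have Dx := D_gt0 _ x0 x1.
  apply: (mulfI (lt0r_neq0 Dx)); rewrite /dh mulrDr mulVKf ?lt0r_neq0//.
  rewrite deriv_poisson_sum mulrCA DE poisson_den_sum -DE.
  rewrite [RHS]mulrC divfK ?lt0r_neq0//.
  by rewrite /D derivD derivB derivZ derivX derivXn derivC !hornerE /= ; ring.
have [xi xiI hE] : exists2 xi, xi \in `[0, r]%R & h r - h 0 = dh xi * (r - 0).
  apply: MVT_segment => //; first exact: ltW.
    move=> x /andP[]; rewrite !bnd_simp => x0 xr; apply: hd; [exact: ltW|exact: lt_trans r1].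
  apply: derivable_within_continuous => x /andP[]; rewrite !bnd_simp => x0 xr.
  by apply: ex_derive; apply: hd => //; exact: le_lt_trans r1.
move: xiI hE; rewrite in_itv /= => /andP[xi0 xir].
have xi1 : xi < 1 by exact: le_lt_trans r1.
have h0 : h 0 = 0.
  rewrite /h /= fctE /= DE /poisson_den mulr0 subr0 expr0n addr0 ln1 add0r.
  by rewrite horner_sum big1// => n _; rewrite hornerZ hornerXn expr0n mulr0.
rewrite h0 !subr0 => hE.
have hr : h r <= 4 * r ^+ N / (1 - r) ^+ 2.
  rewrite hE dhE//; have Dx := D_gt0 _ xi0 xi1.
  have D1 : (1 - r) ^+ 2 <= D.[xi].
    rewrite DE; apply: le_trans (poisson_den_ge _ xi0).
    by rewrite lerXn2r ?nnegrE ?subr_ge0 ?(ltW r1)//; lra.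
  have q1 : 0 < (1 - r) ^+ 2 by rewrite exprn_gt0// subr_gt0.
  have xN : xi ^+ N <= r ^+ N by rewrite lerXn2r ?nnegrE// ltW.
  have xN0 : 0 <= xi ^+ N by rewrite exprn_ge0.
  (* Each of the two terms of [A] is at most r^N in absolute value, and the derivative carries a
     further factor 2: together they give the constant 4. *)
  set A := _ - _.
  have A1 : A <= 2 * r ^+ N.
    apply: le_trans (_ : 2 * xi ^+ N <= _); last by rewrite ler_pM2l.
    rewrite /A exprS.
    have a1 := cos_le1 (N%:R * al); have b1 := cos_geN1 (N.+1%:R * al).
    have : xi * xi ^+ N * cos (N%:R * al) <= xi ^+ N.
      rewrite -mulrA mulrCA -[leRHS]mulr1 ler_wpM2l//.
      have := cos_geN1 (N%:R * al); nra.
    have : - (xi ^+ N) <= xi ^+ N * cos (N.+1%:R * al) by nra.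
    lra.
  have : 2 * A / D.[xi] * r <= 4 * r ^+ N / D.[xi].
    rewrite mulrAC ler_pM2r ?invr_gt0//.
    have r_N : 0 <= r ^+ N by rewrite exprn_ge0 // ltW.
    nra.
  move=> /le_trans; apply; rewrite ler_pM2l ?lef_pV2 ?posrE//.
  by rewrite mulr_gt0// exprn_gt0.
have Dr := D_gt0 _ (ltW r0) r1.
rewrite -DE -[leLHS]lnK ?posrE// ler_expR.
by move: hr; rewrite /h fctE /=; lra.
Qed.

(** At r = 1 this is an equality, by cos a - cos b = - 2 sin ((a + b) / 2) sin ((a - b) / 2). In
    general the difference of the two sides factors as (1 - r)^2 ((1 + r)^2 - 4 r cos a cos b). *)
Lemma chord_le_poisson_den (R : realType) (a b r : R) : 0 < r ->
  (2 * r * `|cos a - cos b|) ^+ 2 <= poisson_den (a + b) r * poisson_den (a - b) r.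
Proof.
move=> r0; rewrite exprMn real_normK ?num_real// /poisson_den cosD cosB.
have a2 := cos2Dsin2 a; have b2 := cos2Dsin2 b.
set x := cos a in a2 *; set y := cos b in b2 *.
set u := sin a in a2 *; set v := sin b in b2 *.
rewrite -subr_ge0.
have -> : (1 - 2 * (x * y - u * v) * r + r ^+ 2) *
   (1 - 2 * (x * y + u * v) * r + r ^+ 2) - (2 * r) ^+ 2 * (x - y) ^+ 2
   = (1 - r) ^+ 2 * ((1 + r) ^+ 2 - 4 * r * (x * y)).
  have uv : u ^+ 2 * v ^+ 2 = (1 - x ^+ 2) * (1 - y ^+ 2).
    by congr (_ * _); lra.
  transitivity ((1 - 2 * (x * y) * r + r ^+ 2) ^+ 2 - 4 * r ^+ 2 * (u ^+ 2 * v ^+ 2)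
     - (2 * r) ^+ 2 * (x - y) ^+ 2); first by ring.
  rewrite uv; ring.
rewrite mulr_ge0 ?sqr_ge0//.
have : x * y <= 1 by have := sqr_ge0 (x - y); have := sqr_ge0 u; have := sqr_ge0 v; nra.
by have := sqr_ge0 (1 - r); nra.
Qed.

(** Adding the sums at a + b and a - b separates the variables, by cos n(a + b) + cos n(a - b) = 2
    cos na cos nb. *)
Lemma poisson_sumD (R : realType) (a b r : R) (N : nat) :
  (poisson_sum (a + b) N).[r] + (poisson_sum (a - b) N).[r] =
  2 * \sum_(n < N) 2 * r ^+ n.+1 / n.+1%:R *
        ((chebyshev R n.+1).[cos a] * (chebyshev R n.+1).[cos b]).
Proof.
rewrite !horner_sum -big_split mulr_sumr; apply: eq_bigr => n _ /=.
rewrite !hornerZ !hornerXn -!/(chebyshev R n.+1) !chebyshev_cos mulrDr mulrBr cosD cosB.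
by ring.
Qed.

Lemma log_kernel_bound1 (R : realType) (e : R) : 0 < e ->
  exists (N : nat) (gam : nat -> R), (forall n, 0 <= gam n) /\
  forall x y, `|x| <= 1 -> `|y| <= 1 ->
    2 * `|x - y| <= expR (e - \sum_(n < N) gam n *
         ((chebyshev R n.+1).[x] * (chebyshev R n.+1).[y])).
Proof.
(* The budget [e] is split in two: removing the factor r from 2 r |x - y| costs - log r = e / 2, and
   [N] is chosen so that truncation costs at most e / 2. *)
move=> e0; pose r : R := expR (- (e / 2)).
have r0 : 0 < r by exact: expR_gt0.
have r1 : r < 1 by rewrite -expR0 ltr_expR; lra.
have [N HN] : exists N : nat, 4 * r ^+ N / (1 - r) ^+ 2 <= e / 2.
  have q1 : 0 < (1 - r) ^+ 2 by rewrite exprn_gt0// subr_gt0.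
  have k0 : 0 < e / 2 * (1 - r) ^+ 2 / 4 by rewrite divr_gt0// mulr_gt0// divr_gt0.
  have : r ^+ n @[n --> \oo] --> 0 by apply: cvg_expr; rewrite gtr0_norm.
  move=> /cvgrPdist_lt /(_ _ k0) [N _ /(_ N (leqnn _))].
  rewrite /= sub0r normrN ger0_norm ?exprn_ge0 ?(ltW r0)// => HN.
  exists N; rewrite ler_pdivrMr//. lra.
exists N, (fun n => 2 * r ^+ n.+1 / n.+1%:R); split.
  by move=> n; rewrite divr_ge0// mulr_ge0// exprn_ge0// ltW.
move=> x y; rewrite !ler_norml => xI yI.
have <- := acosK xI; have <- := acosK yI.
set a := acos x; set b := acos y.
rewrite -(@ler_pM2l _ r)// -(@ler_pXn2r _ 2)// ?nnegrE; last 2 first.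
- by rewrite mulr_ge0 ?mulr_ge0// ltW.
- by rewrite mulr_ge0 ?expR_ge0// ltW.
rewrite mulrCA mulrA; apply: le_trans (chord_le_poisson_den _ _ r0) _.
have := poisson_den_le (a - b) N r0 r1; have := poisson_den_le (a + b) N r0 r1.
have den_ge0 al : 0 <= poisson_den al r.
  by apply: le_trans (poisson_den_ge _ (ltW r0)); rewrite sqr_ge0.
set d := _ / (1 - r) ^+ 2 in HN *.
move=> l1 l2; apply: le_trans (ler_pM (den_ge0 _) (den_ge0 _) l1 l2) _.
rewrite -expRD exprMn -!expRM_natl -expRD ler_expR.
have := poisson_sumD a b r N; lra.
Qed.

Lemma log_kernel_bound (R : realType) (c h e : R) : 0 < h -> 0 < e ->
  exists (N : nat) (gam : nat -> R) (t : nat -> {poly R}),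
    (forall n, 0 <= gam n) /\
    forall x y, `|x - c| <= h -> `|y - c| <= h ->
      `|x - y| <= h / 2 * expR (e - \sum_(n < N) gam n * ((t n).[x] * (t n).[y])).
Proof.
move=> h0 e0; have [N [gam [gam0 H]]] := log_kernel_bound1 e0.
exists N, gam, (fun n => chebyshev R n.+1 \Po (h^-1 *: ('X - c%:P))); split=> // x y xI yI.
have sc (z : R) : `|z - c| <= h -> `|h^-1 * (z - c)| <= 1.
  by move=> zI; rewrite normrM gtr0_norm ?invr_gt0// mulrC ler_pdivrMr// mul1r.
under eq_bigr do rewrite !horner_comp !hornerZ !hornerXsubC.
have := H _ _ (sc _ xI) (sc _ yI).
set ex := expR _; rewrite -mulrBr normrM gtr0_norm ?invr_gt0//.
have -> : x - c - (y - c) = x - y by ring.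
by rewrite mulrCA ler_pdivrMl// => ?; lra.
Qed.

(** * Integrals without measurability assumptions *)

Import HBNNSimple.

(* The library integral is a supremum over simple functions, so monotonicity does not
   require [f] or [g] to be measurable: a simple function below [f] is cut down to [S]. *)
Lemma le_integral_conull (R : realType) (d : measure_display)
    (T : measurableType d) (mu : {measure set T -> \bar R}) (S : set T)
    (f g : T -> \bar R) :
  measurable S -> mu (~` S) = 0%E -> (forall x, S x -> (f x <= g x)%E) ->
  (\int[mu]_x f x <= \int[mu]_x g x)%E.
Proof.
move=> mS muS fg.
have key (u v : T -> \bar R) : (forall x, (0 <= v x)%E) ->
    (forall x, S x -> (u x <= v x)%E) ->
    (ereal_sup [set sintegral mu h |
       h in [set h : {nnsfun T >-> R} | forall x, (h x)%:E <= u x]] <=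
     ereal_sup [set sintegral mu h |
       h in [set h : {nnsfun T >-> R} | forall x, (h x)%:E <= v x]])%E.
  move=> v0 uv; apply: ge_ereal_sup => _ [h /= hu <-].
  apply: ereal_sup_ubound; exists (proj_nnsfun h mS) => /=.
    move=> x; rewrite mindicE; case: (boolP (x \in S)) => [|_].
      by rewrite inE mulr1 => Sx; apply: le_trans (uv _ Sx).
    by rewrite mulr0.
  rewrite -!integralT_nnsfun; apply: ge0_ae_eq_integral => //.
  - by apply/measurable_EFinP; exact: measurable_funP.
  - by apply/measurable_EFinP; exact: measurable_funP.
  - by move=> x _; rewrite lee_fin.
  - by move=> x _; rewrite lee_fin.
  - exists (~` S); split=> //; first exact: measurableC.
    move=> x /= H Sx; apply: H => _; congr (_%:E).
    by rewrite mindicE mem_set// mulr1.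
rewrite integralE [leRHS]integralE.
apply: leeB; rewrite !ge0_integralTE//; apply: key => // x Sx.
- by rewrite !funeposE; apply: le_max2 => //; exact: fg.
- by rewrite !funenegE; apply: le_max2 => //; rewrite leeN2; exact: fg.
Qed.

Lemma eq_integral_conull (R : realType) (d : measure_display)
    (T : measurableType d) (mu : {measure set T -> \bar R}) (S : set T)
    (f g : T -> \bar R) :
  measurable S -> mu (~` S) = 0%E -> (forall x, S x -> f x = g x) ->
  (\int[mu]_x f x = \int[mu]_x g x)%E.
Proof.
move=> mS muS fg; apply/eqP; rewrite eq_le.
by apply/andP; split; apply: (le_integral_conull mS muS) => x Sx; rewrite fg.
Qed.

Lemma bounded_integrable (R : realType) (d : measure_display)
    (T : measurableType d) (mu : {measure set T -> \bar R}) (f : T -> R) (S : set T) (C : R) :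
  (mu setT < +oo)%E -> measurable S -> mu (~` S) = 0%E ->
  measurable_fun setT f -> (forall x, S x -> `|f x| <= C) ->
  mu.-integrable setT (EFin \o f).
Proof.
move=> mufin mS muS mf fC.
apply/(@negligible_integrable _ _ _ mu setT (~` S)) => //.
- exact: measurableC.
- exact/measurable_EFinP.
rewrite setTD setCK; apply: measurable_bounded_integrable => //.
- by apply: le_lt_trans mufin; apply: le_measure; rewrite ?inE.
- exact: measurable_funS mf.
- exists C; split; first exact: num_real.
  by move=> M CM x Sx; apply: le_trans (fC _ Sx) (ltW CM).
Qed.

Lemma probability_bounded_integrable (R : realType) (d : measure_display)
    (T : measurableType d) (mu : probability T R) (f : T -> R) (C : R) :
  measurable_fun setT f -> (forall x, `|f x| <= C) -> mu.-integrable setT (EFin \o f).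
Proof.
move=> mf fC.
have muT : (mu setT < +oo)%E by rewrite probability_setT ltry.
have mu0 : mu (~` setT) = 0%E by rewrite setCT measure0.
by apply: (bounded_integrable (S := setT) (C := C) muT _ mu0) => // x _; exact: fC.
Qed.

(** * Spectra of real symmetric matrices *)

Lemma real_symmetric_diag (R : realType) (n : nat) (J : 'M[R]_n) :
  J^T = J ->
  exists (P : 'M[R[i]]_n) (x : 'I_n -> R),
    P *m (map_mx Num.conj P)^T = 1%:M /\
    P *m map_mx (real_complex R) J = diag_mx (\row_i (x i)%:C) *m P.
Proof.
move=> Jsym; pose A := map_mx (real_complex R) J.
have Aherm : A \is hermsymmx.
  apply: realsym_hermsym.
    by apply/is_hermitianmxP; rewrite expr0 scale1r map_mx_id// /A map_trmx Jsym.
  by apply/mxOverP => i j; rewrite mxE; apply/complex_realP; exists (J i j).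
exists (spectralmx A), (fun i => complex.Re (spectral_diag A 0 i)); split.
  by rewrite map_trmx; apply/unitarymxP; exact: spectral_unitarymx.
have /hermitian_normalmx /orthomx_spectralP A_eq := Aherm.
rewrite -/A {2}A_eq mulmxA mulmxA mulmxV ?spectral_unit// mul1mx.
congr (diag_mx _ *m _); apply/rowP => i; rewrite mxE RRe_real//.
by have /mxOverP := hermitian_spectral_diag_real Aherm; exact.
Qed.

Lemma Re_mul_real_conj (R : realType) (z w : R[i]) (r : R) :
  complex.Re (z * r%:C * w^*) =
  complex.Re z * r * complex.Re w + complex.Im z * r * complex.Im w.
Proof. by case: z w => [a b] [c d] /=; ring. Qed.

Definition mxpow (R : pzSemiRingType) (n : nat) (J : 'M[R]_n) (k : nat) : 'M[R]_n :=
  iter k (mulmx J) 1%:M.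

(** The eigenvectors are complex while the form bounds concern real vectors. For a unit eigenvector,
    the eigenvalue is the sum of the form at its real part and at its imaginary part, whose squared
    norms add up to 1. *)
Lemma real_symmetric_spectrum (R : realType) (n : nat) (J : 'M[R]_n) (lm lM : R) :
  J^T = J ->
  (forall u : 'I_n -> R,
     lm * (\sum_i u i ^+ 2) <= \sum_i \sum_j u i * J i j * u j <= lM * (\sum_i u i ^+ 2)) ->
  exists x : 'I_n -> R,
    [/\ forall i, lm <= x i <= lM,
        forall E, \det (E%:M - J) = \prod_i (E - x i) &
        forall k, \tr (mxpow J k) = \sum_i x i ^+ k].
Proof.
move=> Jsym Jlu; have [P [x [PU PJ]]] := real_symmetric_diag Jsym.
exists x; set A := map_mx _ J in PJ.
have [Punit _] := mulmx1_unit PU.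
have Pinv : invmx P = (map_mx Num.conj P)^T by rewrite -[RHS](mulKmx Punit) PU mulmx1.
have AE : A = invmx P *m diag_mx (\row_i (x i)%:C) *m P.
  by rewrite -mulmxA -PJ mulKmx.
split.
- move=> i.
  have norm1 : \sum_a (complex.Re (P i a) ^+ 2 + complex.Im (P i a) ^+ 2) = 1.
    have /matrixP/(_ i i) := PU; rewrite !mxE eqxx => /(congr1 (@complex.Re R)).
    rewrite raddf_sum /= => <-; apply: eq_bigr => a _; rewrite !mxE.
    by have := Re_mul_real_conj (P i a) (P i a) 1; rewrite rmorph1 !mulr1 => ->; ring.
  have xE : x i = \sum_a \sum_b (complex.Re (P i a) * J a b * complex.Re (P i b) +
      complex.Im (P i a) * J a b * complex.Im (P i b)).
    have /(congr1 (mulmxr (invmx P))) := PJ; rewrite /= mulmxK// Pinv.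
    move=> /matrixP/(_ i i); rewrite !mxE eqxx mulr1n => /(congr1 (@complex.Re R)) /= <-.
    rewrite raddf_sum /= exchange_big; apply: eq_bigr => b _; rewrite !mxE mulr_suml raddf_sum.
    by apply: eq_bigr => a _; rewrite !mxE -Re_mul_real_conj.
  have /andP[l1 u1] := Jlu (fun a => complex.Re (P i a)).
  have /andP[l2 u2] := Jlu (fun a => complex.Im (P i a)).
  have -> : x i = \sum_a \sum_b (complex.Re (P i a) * J a b * complex.Re (P i b)) +
      \sum_a \sum_b (complex.Im (P i a) * J a b * complex.Im (P i b)).
    by rewrite xE -big_split; apply: eq_bigr => a _; rewrite big_split.
  rewrite big_split /= in norm1.
  rewrite -[lm]mulr1 -[lM]mulr1 -norm1 !mulrDr.
  by apply/andP; split; apply: lerD.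
- move=> E; apply: complexI; rewrite -det_map_mx map_mxB map_scalar_mx /= -/A.
  have -> : (E%:C)%:M - A = invmx P *m diag_mx (\row_i (E - x i)%:C) *m P.
    have -> : diag_mx (\row_i (E - x i)%:C) = (E%:C)%:M - diag_mx (\row_i (x i)%:C).
      apply/matrixP => a b; rewrite !mxE.
      by case: (a == b); rewrite ?mulr1n ?mulr0n ?subr0// rmorphB.
    rewrite mulmxBr mulmxBl -AE; congr (_ - _).
    by rewrite mul_mx_scalar -scalemxAl mulVmx// scalemx1.
  rewrite !det_mulmx mulrAC -det_mulmx mulVmx// det1 mul1r det_diag rmorph_prod.
  by apply: eq_bigr => i _; rewrite mxE.
- move=> k; apply: complexI; rewrite -trace_map_mx.
  have -> : map_mx (real_complex R) (mxpow J k) =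
            invmx P *m diag_mx (\row_i (x i ^+ k)%:C) *m P.
    elim: k => [|k IH].
      have -> : \row_i (x i ^+ 0)%:C = const_mx 1 by apply/rowP => i; rewrite !mxE expr0.
      by rewrite diag_const_mx mulmx1 mulVmx// map_mx1.
    rewrite /mxpow /= map_mxM -/(mxpow J k) IH -/A {1}AE.
    rewrite -!mulmxA; congr (_ *m _); rewrite !mulmxA mulmxK//; congr (_ *m _).
    rewrite mulmx_diag; congr diag_mx; apply/rowP => i.
    by rewrite !mxE exprS rmorphM.
  rewrite mxtrace_mulC mulmxA mulmxV// mul1mx mxtrace_diag rmorph_sum.
  by apply: eq_bigr => i _; rewrite mxE.
Qed.

(** * Transfer matrices and truncated Jacobi matrices *)

Definition jacobi_mx (R : realType) (a b : nat -> R) (n : nat) : 'M[R]_n :=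
  \matrix_(i, j) (if i == j :> nat then b i
                  else if i.+1 == j then a i
                  else if j.+1 == i then a j else 0).

Definition jacobi_det (R : realType) (a b : nat -> R) (n : nat) (E : R) : R :=
  \det (E%:M - jacobi_mx a b n).

(** The expansion removes sites at the left end, because dropping the first site of an orbit amounts
    to replacing [w] by [T w]; [cocycleRS] peels the cocycle at the same end. *)
Lemma jacobi_det_rec (R : realType) (a b : nat -> R) (n : nat) (E : R) :
  jacobi_det a b n.+2 E =
    (E - b 0%N) * jacobi_det (fun i => a i.+1) (fun i => b i.+1) n.+1 E
    - a 0%N ^+ 2 * jacobi_det (fun i => a i.+2) (fun i => b i.+2) n E.
Proof.
rewrite /jacobi_det (expand_det_row _ ord0) 2!big_ord_recl big1 ?addr0; last first.
  by move=> i _; rewrite !mxE /= subr0 mul0r.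
rewrite /cofactor /= !expr0 expr1 mul1r !mulN1r; congr (_ * _ + _).
- by rewrite !mxE mulr1n.
- by congr (\det _); apply/matrixP => i j; rewrite !mxE.
rewrite !mxE /= mulr0n sub0r mulrN mulNr opprK.
rewrite (expand_det_col _ ord0) big_ord_recl big1 ?addr0; last first.
  by move=> i _; rewrite !mxE /= subr0 mul0r.
rewrite /cofactor /= !mxE /= mulr0n sub0r expr0 mul1r mulNr mulrN mulrA -expr2.
congr (- (_ * _)); congr (\det _); apply/matrixP => i j.
by rewrite !mxE.
Qed.

Lemma det_mx2 (R : comNzRingType) (M : 'M[R]_2) :
  \det M = M 0 0 * M 1 1 - M 0 1 * M 1 0.
Proof.
have e1 : lift 0 (0 : 'I_1) = 1 :> 'I_2 by apply/val_inj.
have e0 : lift 1 (0 : 'I_1) = 0 :> 'I_2 by apply/val_inj.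
rewrite (expand_det_row _ 0) !big_ord_recl big_ord0 addr0 e1 /cofactor.
by rewrite expr0 expr1 mul1r mulN1r !det_mx11 !mxE e1 e0 mulrN.
Qed.

Section TransferMatrix.
Variables (R : realType) (Omega : Type) (T : Omega -> Omega) (f g : Omega -> R).

Definition transferR (E : R) (w : Omega) : 'M[R]_2 :=
  (f (T w))^-1 *: (block_mx (E - g (T w))%:M (- f w)%:M (f (T w))%:M 0 : 'M[R]_(1 + 1)).

Fixpoint cocycleR (E : R) (n : nat) (w : Omega) : 'M[R]_2 :=
  if n is m.+1 then transferR E (iter m T w) *m cocycleR E m w else 1%:M.

Lemma cocycle_real (E : R) (n : nat) (w : Omega) :
  cocycle T f g E%:C n w = map_mx (real_complex R) (cocycleR E n w).
Proof.
elim: n => [|n IH] /=; first by rewrite map_mx1.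
rewrite map_mxM -IH; congr (_ *m _).
rewrite /transfer /transferR map_mxZ; congr (_ *: _).
rewrite (@map_block_mx _ _ (real_complex R) 1 1 1 1) !map_scalar_mx map_mx0.
by rewrite (rmorphB (real_complex R)) (rmorphN (real_complex R)).
Qed.

Lemma transferRE (E : R) (w : Omega) :
  [/\ transferR E w 0 0 = (E - g (T w)) / f (T w),
      transferR E w 0 1 = - f w / f (T w),
      transferR E w 1 0 = f (T w) / f (T w) &
      transferR E w 1 1 = 0].
Proof.
have e0 : (0 : 'I_2) = lshift 1 (0 : 'I_1) by apply/val_inj.
have e1 : (1 : 'I_2) = rshift 1 (0 : 'I_1) by apply/val_inj.
rewrite e0 e1 /transferR; split; rewrite mxE.
- by rewrite block_mxEul mxE eqxx mulr1n mulrC.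
- by rewrite block_mxEur mxE eqxx mulr1n mulrC.
- by rewrite block_mxEdl mxE eqxx mulr1n mulrC.
- by rewrite block_mxEdr mxE mulr0.
Qed.

Lemma cocycleRS (E : R) (n : nat) (w : Omega) :
  cocycleR E n.+1 w = cocycleR E n (T w) *m transferR E w.
Proof.
elim: n => [|n IH]; first by rewrite /= mulmx1 mul1mx.
by rewrite -[LHS]/(transferR E (iter n.+1 T w) *m cocycleR E n.+1 w) IH mulmxA iterSr.
Qed.

Hypothesis f_gt0 : forall w, 0 < f w.

(** The one-step determinants f(w) / f(T w) telescope. This is what later bounds the norm of the
    cocycle from below. *)
Lemma det_cocycleR (E : R) (n : nat) (w : Omega) :
  \det (cocycleR E n w) = f w / f (iter n T w).
Proof.
have fn0 x := lt0r_neq0 (f_gt0 x).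
elim: n => [|n IH]; first by rewrite det1 divff.
rewrite /= det_mulmx IH det_mx2.
have [-> -> -> ->] := transferRE E (iter n T w).
by rewrite mulr0 sub0r divff// mulr1 !mulNr opprK mulrC mulrA divfK.
Qed.

Definition window_det (n : nat) (E : R) (w : Omega) : R :=
  jacobi_det (fun i => f (iter i.+1 T w)) (fun i => g (iter i.+1 T w)) n E.

Definition bond_prod (n : nat) (w : Omega) : R := \prod_(k < n) f (iter k.+1 T w).

Lemma bond_prod_gt0 (n : nat) (w : Omega) : 0 < bond_prod n w.
Proof. exact: prodr_gt0. Qed.

Lemma bond_prodS (n : nat) (w : Omega) : bond_prod n.+1 w = f (T w) * bond_prod n (T w).
Proof.
rewrite /bond_prod big_ord_recl /=; congr (_ * _); apply: eq_bigr => i _.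
by rewrite -!iterS -!iterSr.
Qed.

Lemma window_detSS (n : nat) (E : R) (w : Omega) :
  window_det n.+2 E w = (E - g (T w)) * window_det n.+1 E (T w)
    - f (T w) ^+ 2 * window_det n E (T (T w)).
Proof.
rewrite /window_det jacobi_det_rec.
congr (_ * _ - _ * _); congr (jacobi_det _ _ _ _); apply/funext => i;
  by rewrite -?iterSr -?[T (T w)]/(iter 2 T w) -?iterD ?addn2.
Qed.

(** These entries are the orthogonal polynomials of the first and second kind: the characteristic
    polynomial of a truncation satisfies the same three-term recurrence as the solutions, up to the
    product of the off-diagonal entries. *)
Lemma cocycleR_row0 (E : R) (n : nat) (w : Omega) :
  cocycleR E n.+1 w 0 0 = window_det n.+1 E w / bond_prod n.+1 w /\
  cocycleR E n.+1 w 0 1 = - f w * window_det n E (T w) / bond_prod n.+1 w.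
Proof.
have fn0 x := lt0r_neq0 (f_gt0 x).
elim: n w => [|n IH] w.
  have [t00 t01 _ _] := transferRE E w.
  rewrite /= mulmx1 t00 t01 /bond_prod big_ord1 /window_det /jacobi_det det_mx11 det_mx00.
  by rewrite !mxE /= mulr1n mulr1.
have [t00 t01 t10 t11] := transferRE E w.
have [IH0 IH1] := IH (T w).
have pn0 := lt0r_neq0 (bond_prod_gt0 n.+1 (T w)).
rewrite cocycleRS !mxE !big_ord_recl !big_ord0 !addr0.
have -> : lift ord0 (ord0 : 'I_1) = 1 :> 'I_2 by apply/val_inj.
rewrite [bond_prod n.+2 w]bond_prodS IH0 IH1 t00 t01 t10 t11 window_detSS.
by split; field; rewrite pn0 fn0.
Qed.

Lemma cocycleR_row1 (E : R) (n : nat) (w : Omega) (j : 'I_2) :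
  cocycleR E n.+1 w 1 j = cocycleR E n w 0 j.
Proof.
have [_ _ t10 t11] := transferRE E (iter n T w).
rewrite /= !mxE !big_ord_recl !big_ord0 !addr0.
have -> : lift ord0 (ord0 : 'I_1) = 1 :> 'I_2 by apply/val_inj.
by rewrite t10 t11 divff ?lt0r_neq0// mul1r mul0r addr0.
Qed.

End TransferMatrix.

(** * The operator norm *)

Lemma normc_real (R : realType) (x : R) : Normc.normc x%:C = `|x|.
Proof. by rewrite /Normc.normc /= expr0n addr0 sqrtr_sqr. Qed.

Lemma normc_ge0 (R : realType) (z : R[i]) : 0 <= Normc.normc z.
Proof. by case: z => a b; exact: sqrtr_ge0. Qed.

Lemma le_normc_sum (R : realType) (I : Type) (s : seq I) (F : I -> R[i]) :
  Normc.normc (\sum_(i <- s) F i) <= \sum_(i <- s) Normc.normc (F i).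
Proof.
elim/big_rec2: _ => [|i y x _ xy]; first by rewrite Normc.normc0.
apply: le_trans (lerD (lexx _) xy).
by have := ler_normD (F i) x; rewrite -[_ + _ in X in _ <= X]rmorphD lecR.
Qed.

Lemma sqr_enorm (R : realType) (m : nat) (v : 'cV[R[i]]_m) :
  enorm v ^+ 2 = \sum_i Normc.normc (v i 0) ^+ 2.
Proof. by rewrite sqr_sqrtr// sumr_ge0// => i _; rewrite sqr_ge0. Qed.

Lemma enorm_le_sum (R : realType) (m : nat) (v : 'cV[R[i]]_m) :
  enorm v <= \sum_i Normc.normc (v i 0).
Proof.
have s0 i : 0 <= Normc.normc (v i 0) by exact: normc_ge0.
rewrite -(@ler_pXn2r _ 2)// ?nnegrE ?sqrtr_ge0 ?sumr_ge0// sqr_enorm.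
rewrite expr2 mulr_suml; apply: ler_sum => i _.
by rewrite expr2 ler_wpM2l// (bigD1 i)//= lerDl sumr_ge0.
Qed.

Lemma normc_le_enorm (R : realType) (m : nat) (v : 'cV[R[i]]_m) (i : 'I_m) :
  Normc.normc (v i 0) <= enorm v.
Proof.
rewrite -(@ler_pXn2r _ 2)// ?nnegrE ?sqrtr_ge0 ?normc_ge0// sqr_enorm.
by rewrite (bigD1 i)//= lerDl sumr_ge0// => j _; rewrite sqr_ge0.
Qed.

Lemma enorm_mul_le (R : realType) (m : nat) (M : 'M[R[i]]_m) (v : 'cV[R[i]]_m) :
  enorm v <= 1 -> enorm (M *m v) <= \sum_i \sum_j Normc.normc (M i j).
Proof.
move=> v1; apply: le_trans (enorm_le_sum _) _; apply: ler_sum => i _.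
rewrite mxE; apply: le_trans (le_normc_sum _ _) _; apply: ler_sum => j _.
rewrite Normc.normcM -[leRHS]mulr1 ler_wpM2l ?normc_ge0//.
exact: le_trans (normc_le_enorm _ _) v1.
Qed.

(** A crude comparison is enough: a constant factor in the norm disappears once its logarithm is
    divided by the number of steps. *)
Lemma opnorm_real_le (R : realType) (m : nat) (M : 'M[R]_m) :
  opnorm (map_mx (real_complex R) M) <= \sum_i \sum_j `|M i j|.
Proof.
apply: sup_le_ub.
  exists (enorm (map_mx (real_complex R) M *m 0)); exists 0 => //=.
  apply: le_trans (enorm_le_sum _) _.
  by rewrite big1 ?ler01// => i _; rewrite mxE Normc.normc0.
move=> _ [v /= v1 <-]; apply: le_trans (enorm_mul_le _ v1) _.
by apply: ler_sum => i _; apply: ler_sum => j _; rewrite mxE normc_real.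
Qed.

Lemma le_opnorm_real (R : realType) (m : nat) (M : 'M[R]_m) (i j : 'I_m) :
  `|M i j| <= opnorm (map_mx (real_complex R) M).
Proof.
set N := map_mx _ M.
have v1 : enorm (delta_mx j 0 : 'cV[R[i]]_m) <= 1.
  rewrite -(@ler_pXn2r _ 2)// ?nnegrE ?sqrtr_ge0// sqr_enorm (bigD1 j)//= big1.
    by rewrite mxE !eqxx Normc.normc1 addr0.
  by move=> k /negbTE kj; rewrite mxE kj Normc.normc0 expr0n.
apply: le_trans (_ : enorm (N *m delta_mx j 0) <= _).
  by rewrite -colE; apply: le_trans (normc_le_enorm _ i); rewrite !mxE normc_real.
apply: ub_le_sup; last by exists (delta_mx j 0).
exists (\sum_i \sum_j Normc.normc (N i j)) => _ [v /= v1' <-].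
exact: enorm_mul_le.
Qed.

(** * The numerical range of a Jacobi operator *)

Definition jacobiR (R : realType) (a b : nat -> R) (u : nat -> R) : nat -> R :=
  fun n => (if n is m.+1 then a n * u m else 0) + b n.+1 * u n + a n.+1 * u n.+1.

Definition dotn (R : realType) (n : nat) (u v : nat -> R) : R := \sum_(i < n) u i * v i.

Definition supported (R : realType) (n : nat) (u : nat -> R) : Prop :=
  forall i, (n <= i)%N -> u i = 0.

Section JacobiForm.
Variables (R : realType) (a b : nat -> R).
Local Notation J := (jacobiR a b).

Lemma supportedW (m n : nat) (u : nat -> R) : (m <= n)%N -> supported m u -> supported n u.
Proof. by move=> mn um i /(leq_trans mn)/um. Qed.

Lemma dotn_widen (m n : nat) (u v : nat -> R) : (m <= n)%N -> supported m u ->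
  dotn n u v = dotn m u v.
Proof.
move=> mn um; rewrite /dotn -(subnKC mn) big_split_ord /= [X in _ + X]big1 ?addr0//.
by move=> i _; rewrite um ?mul0r// leq_addr.
Qed.

Lemma dotn_ge0 (n : nat) (u : nat -> R) : 0 <= dotn n u u.
Proof. by apply: sumr_ge0 => i _; rewrite -expr2 sqr_ge0. Qed.

Lemma jacobiR_supported (n : nat) (u : nat -> R) : supported n u -> supported n.+1 (J u).
Proof.
by move=> un [//|i] ni; rewrite /jacobiR !un ?mulr0 ?addr0//; lia.
Qed.

(** Discrete Green formula: the sum telescopes to the Wronskian at the right end. The left end
    contributes nothing, by the convention a_0 = 0. *)
Lemma jacobiR_green (n : nat) (u v : nat -> R) :
  dotn n.+1 (J u) v - dotn n.+1 u (J v) = a n.+1 * (u n.+1 * v n - u n * v n.+1).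
Proof.
rewrite /dotn; elim: n => [|n IH]; first by rewrite !big_ord1 /jacobiR /=; ring.
rewrite big_ord_recr [X in _ - X]big_ord_recr /= opprD addrACA IH /jacobiR /=; ring.
Qed.

Lemma jacobiR_sym (n : nat) (u v : nat -> R) : supported n u -> supported n v ->
  dotn n.+1 (J u) v = dotn n.+1 u (J v).
Proof.
move=> un vn; apply/eqP; rewrite -subr_eq0 jacobiR_green.
by rewrite (un n.+1)// (vn n.+1)// mul0r mulr0 subr0 mulr0.
Qed.

Variable C : R.
Hypotheses (aC : forall n, `|a n| <= C) (bC : forall n, `|b n| <= C).

(** The diagonal and the two neighbours contribute [C] each, by Young's inequality. The bound makes
    the supremum of the form finite in [jacobiR_form_le]. *)
Lemma jacobiR_form_bound (n : nat) (u : nat -> R) : supported n u ->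
  `|dotn n u (J u)| <= 3 * C * dotn n u u.
Proof.
move=> un; have C0 : 0 <= C by apply: le_trans (aC 0%N).
have shift (v : nat -> R) : (forall i, 0 <= v i) -> v n = 0 ->
    \sum_(i < n) v i.+1 <= \sum_(i < n) v i.
  move=> v0 vn; suff : \sum_(i < n) v i.+1 <= \sum_(i < n) v i + v n by rewrite vn addr0.
  have -> : \sum_(i < n) v i + v n = \sum_(i < n.+1) v i by rewrite big_ord_recr.
  by rewrite big_ord_recl /= lerDr.
have young (c x y : R) : `|c| <= C -> `|x * (c * y)| <= C / 2 * (x ^+ 2 + y ^+ 2).
  move=> cC; rewrite mulrCA normrM; apply: le_trans (ler_wpM2r (normr_ge0 _) cC) _.
  rewrite -mulrA ler_wpM2l// ler_norml.
  by have := sqr_ge0 (x - y); have := sqr_ge0 (x + y); nra.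
pose prev (i : nat) := if i is m.+1 then u m ^+ 2 else 0.
apply: le_trans (ler_norm_sum _ _ _) _.
apply: le_trans (_ : \sum_(i < n) (C / 2 * prev i + 2 * C * u i ^+ 2 + C / 2 * u i.+1 ^+ 2) <= _).
  apply: ler_sum => i _; rewrite /jacobiR !mulrDr.
  apply: le_trans (ler_normD _ _) _; apply: le_trans (lerD (ler_normD _ _) (lexx _)) _.
  have h1 := young _ (u i) (u i) (bC i.+1); have h2 := young _ (u i) (u i.+1) (aC i.+1).
  have h3 : `|u i * (match i : nat with 0 => 0 | m.+1 => a i * u m end)| <=
            C / 2 * (u i ^+ 2 + prev i).
    rewrite /prev; case: (i : nat) => [|m]; last exact: young.
    by rewrite mulr0 normr0 mulr_ge0 ?divr_ge0// addr0 sqr_ge0.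
  by move: h1 h2 h3; lra.
have -> : dotn n u u = \sum_(i < n) u i ^+ 2 by apply: eq_bigr => i _; rewrite expr2.
rewrite !big_split /= -!mulr_sumr.
have s1 : \sum_(i < n) prev i <= \sum_(i < n) u i ^+ 2.
  case: (n) => [|m]; first by rewrite !big_ord0.
  by rewrite big_ord_recl big_ord_recr /= add0r lerDl sqr_ge0.
have s2 := shift (fun i => u i ^+ 2) (fun i => sqr_ge0 _).
rewrite un ?leqnn// expr0n in s2; have {}s2 := s2 erefl.
by have := ler_wpM2l C0 s1; have := ler_wpM2l C0 s2; lra.
Qed.

(* A lower bound on [c - J] of order |u|^2, for all c above [lM], pushes the
   supremum c of the form strictly below itself, because B^2 <= M B for B = c - J. *)
Lemma jacobiR_form_le (lM : R) :
  (forall c, lM < c -> exists K : R, forall n u, supported n u ->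
     dotn n u u <= K * dotn n.+1 (fun i => J u i - c * u i) (fun i => J u i - c * u i)) ->
  forall n u, supported n u -> dotn n u (J u) <= lM * dotn n u u.
Proof.
move=> HK.
pose S := [set q | exists n u, [/\ supported n u, dotn n u u = 1 & q = dotn n u (J u)]].
have C0 : 0 <= C by apply: le_trans (aC 0%N).
have Sub : ubound S (3 * C).
  move=> _ [n [u [un u1 ->]]]; apply: le_trans (ler_norm _) _.
  by apply: le_trans (jacobiR_form_bound un) _; rewrite u1 mulr1.
have S0 : S !=set0.
  exists (dotn 1 (fun i => (i == 0%N)%:R) (J (fun i => (i == 0%N)%:R))).
  exists 1%N, (fun i => (i == 0%N)%:R); split=> //; first by case.
  by rewrite /dotn big_ord1 mulr1.
have Sup : has_sup S by split=> //; exists (3 * C).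
pose c := sup S.
have qc n u : supported n u -> dotn n u (J u) <= c * dotn n u u.
  move=> un; have [u0|u_neq0] := eqVneq (dotn n u u) 0.
    by have := jacobiR_form_bound un; rewrite u0 !mulr0 normr_le0 => /eqP ->.
  have upos : 0 < dotn n u u by rewrite lt_def u_neq0 dotn_ge0.
  pose s := (Num.sqrt (dotn n u u))^-1.
  have s2 : s ^+ 2 = (dotn n u u)^-1 by rewrite exprVn sqr_sqrtr// dotn_ge0.
  have : S (dotn n (fun i => s * u i) (J (fun i => s * u i))).
    exists n, (fun i => s * u i); split=> //.
      by move=> i ni; rewrite un// mulr0.
    rewrite -[RHS](mulVf u_neq0) -s2 /dotn mulr_sumr; apply: eq_bigr => i _; ring.
  move=> /(ub_le_sup (proj2 Sup)); rewrite -/c.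
  have -> : dotn n (fun i => s * u i) (J (fun i => s * u i)) = dotn n u (J u) / dotn n u u.
    rewrite mulrC -s2 /dotn mulr_sumr; apply: eq_bigr => i _; rewrite /jacobiR.
    by case: (i : nat) => [|m]; ring.
  by rewrite ler_pdivrMr.
have [clM n u un|lMc] := leP c lM.
  by apply: le_trans (qc _ _ un) _; rewrite ler_wpM2r// dotn_ge0.
exfalso; have [K {}HK] := HK _ lMc.
pose B u i := c * u i - J u i.
pose M := `|c| + 3 * C + 1.
have M0 : 0 < M by rewrite /M; have := normr_ge0 c; lra.
have dB n u : dotn n u (B u) = c * dotn n u u - dotn n u (J u).
  by rewrite /dotn mulr_sumr -sumrB; apply: eq_bigr => i _; rewrite /B; ring.
have B_ge0 n u : supported n u -> 0 <= dotn n u (B u).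
  by move=> un; rewrite dB subr_ge0; exact: qc.
have B_le n u : supported n u -> dotn n u (B u) <= M * dotn n u u.
  move=> un; rewrite dB /M !mulrDl mul1r.
  have := jacobiR_form_bound un; rewrite ler_norml => /andP[+ _].
  have := ler_wpM2r (dotn_ge0 n u) (ler_norm c); have := dotn_ge0 n u; lra.
have Bsupp n u : supported n u -> supported n.+1 (B u).
  by move=> un i ni; rewrite /B (jacobiR_supported un)// un ?mulr0 ?subr0// ltnW.
(* B^2 <= M B without square roots of operators: the form of [B] is nonnegative at the test vector u
   - B u / M. Expanding it and bounding the last term, the form of [B] at B u, by M |B u|^2 gives
   the claim. *)
have BB n u : supported n u -> dotn n.+1 (B u) (B u) <= M * dotn n u (B u).
  move=> un; pose t := M^-1.
  pose v i := u i - t * B u i.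
  have un1 : supported n.+1 u by apply: supportedW un.
  have vs : supported n.+1 v.
    by move=> i ni; rewrite /v (Bsupp _ _ un)// un1// mulr0 subr0.
  have := B_ge0 _ _ vs.
  have symB : dotn n.+2 u (B (B u)) = dotn n.+2 (B u) (B u).
    have /eqP := jacobiR_sym un1 (Bsupp _ _ un); rewrite -subr_eq0 => /eqP h.
    apply/eqP; rewrite -subr_eq0; apply/eqP; rewrite -[RHS]h.
    by rewrite /dotn -!sumrB; apply: eq_bigr => i _; rewrite /B; ring.
  have -> : dotn n.+1 v (B v) = dotn n u (B u) - 2 * t * dotn n.+1 (B u) (B u)
      + t ^+ 2 * dotn n.+1 (B u) (B (B u)).
    rewrite -(@dotn_widen n.+1 n.+2 v)// -(@dotn_widen n n.+2 u)//; last by lia.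
    rewrite -![dotn n.+1 (B u) _](@dotn_widen n.+1 n.+2 (B u)) //; try exact: Bsupp.
    have -> : dotn n.+2 v (B v) = dotn n.+2 u (B u) - t * dotn n.+2 (B u) (B u)
         - t * dotn n.+2 u (B (B u)) + t ^+ 2 * dotn n.+2 (B u) (B (B u)).
      rewrite /dotn !mulr_sumr -!sumrB -big_split; apply: eq_bigr => i _ /=.
      have -> : B v i = B u i - t * B (B u) i.
        by rewrite /B /v /jacobiR; case: (i : nat) => [|m]; rewrite /B /jacobiR; ring.
      rewrite /v; ring.
    by rewrite symB; ring.
  have := B_le _ _ (Bsupp _ _ un).
  set x := dotn n u (B u); set y := dotn n.+1 (B u) (B u); set z := dotn _ _ _.
  move=> zy h.
  have : t ^+ 2 * z <= t * y.
    have -> : t * y = t ^+ 2 * (M * y) by rewrite /t; field; exact: lt0r_neq0.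
    by rewrite ler_wpM2l// sqr_ge0.
  move=> h2; have : t * y <= x by lra.
  by rewrite /t mulrC ler_pdivrMr// mulrC.
have Kq q : S q -> 1 <= K * M * (c - q).
  move=> [n [u [un u1 ->]]]; have := HK _ _ un; rewrite u1.
  have -> : dotn n.+1 (fun i => J u i - c * u i) (fun i => J u i - c * u i) =
      dotn n.+1 (B u) (B u) by apply: eq_bigr => i _; rewrite /B; ring.
  have := BB _ _ un; rewrite dB u1 mulr1; set y := dotn n.+1 _ _ => y1 y2.
  have y0 : 0 <= y by exact: dotn_ge0.
  have K0 : 0 < K by rewrite ltNge; apply/negP => K0; nra.
  by rewrite -mulrA; apply: le_trans y2 _; rewrite ler_pM2l.
have [q0 Sq0] := S0.
have KM0 : 0 < K * M.
  have := Kq _ Sq0; have : q0 <= c := ub_le_sup (proj2 Sup) Sq0.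
  by move=> h1 h2; rewrite ltNge; apply/negP => h3; nra.
have : c <= c - (K * M)^-1.
  apply: sup_le_ub => // q /Kq; rewrite -ler_pdivrMl// mulr1; lra.
have h : 0 < (K * M)^-1 by rewrite invr_gt0.
by lra.
Qed.

End JacobiForm.

Lemma l2sq_real (R : realType) (n : nat) (u : nat -> R) : supported n u ->
  l2sq (fun i => (u i)%:C) = (dotn n u u)%:E.
Proof.
move=> un; rewrite /l2sq.
rewrite -(nneseries_esumT (a := fun i => (Normc.normc (u i)%:C ^+ 2)%:E)); last first.
  by move=> i; rewrite lee_fin sqr_ge0.
rewrite (nneseries_split 0 n); last by move=> i _; rewrite lee_fin sqr_ge0.
rewrite add0n eseries0 ?adde0; last first.
  by move=> i ni _; rewrite (un i ni) Normc.normc0 expr0n.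
rewrite big_mkord sumEFin; congr (_%:E); apply: eq_bigr => i _.
by rewrite /Normc.normc /= expr0n addr0 sqr_sqrtr ?sqr_ge0// expr2.
Qed.

Lemma jacobi_real (R : realType) (a b u : nat -> R) (i : nat) :
  jacobi a b (fun i => (u i)%:C) i = (jacobiR a b u i)%:C.
Proof. by rewrite /jacobi /jacobiR; case: i => [|i]; rewrite !rmorphD !rmorphM. Qed.

Lemma resolvent_bound (R : realType) (a b : nat -> R) (c : R) :
  resolvent_set (jacobi a b) c%:C ->
  exists K : R, forall n u, supported n u ->
    dotn n u u <= K * dotn n.+1 (fun i => jacobiR a b u i - c * u i)
                                (fun i => jacobiR a b u i - c * u i).
Proof.
move=> [_ [K HK]]; exists K => n u un.
have Jun : supported n.+1 (fun i => jacobiR a b u i - c * u i).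
  by move=> i ni; rewrite (jacobiR_supported a b un ni) un ?mulr0 ?subr0// ltnW.
have := HK (fun i => (u i)%:C).
rewrite /l2 /= (l2sq_real un) ltry => /(_ isT).
have -> : (fun i => jacobi a b (fun i => (u i)%:C) i - c%:C * (u i)%:C) =
          (fun i => (jacobiR a b u i - c * u i)%:C).
  by apply/funext => i; rewrite jacobi_real rmorphB rmorphM.
by rewrite (l2sq_real Jun) -EFinM lee_fin.
Qed.

(** Every real point above [lM] or below [lm] lies in the resolvent set. The upper bound is then
    [jacobiR_form_le], and the lower one is the same lemma for the operator with coefficients -a and
    -b. *)
Lemma jacobi_form_spectrum (R : realType) (a b : nat -> R) (C : R) (Sigma : set R) (lm lM : R) :
  (forall n, `|a n| <= C) -> (forall n, `|b n| <= C) ->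
  spectrum (jacobi a b) = [set x%:C | x in Sigma] ->
  (forall x, Sigma x -> lm <= x) -> (forall x, Sigma x -> x <= lM) ->
  forall n u, supported n u ->
    lm * dotn n u u <= dotn n u (jacobiR a b u) <= lM * dotn n u u.
Proof.
move=> aC bC spE lmS lMS n u un.
have res (c : R) : ~ Sigma c -> resolvent_set (jacobi a b) c%:C.
  move=> Sc; apply: contrapT => nres.
  have : spectrum (jacobi a b) c%:C by [].
  by rewrite spE => -[x Sx /complexI xc]; apply: Sc; rewrite -xc.
apply/andP; split; last first.
  apply: (jacobiR_form_le aC bC) un => c lMc.
  by apply: resolvent_bound; apply: res => /lMS; rewrite leNgt lMc.
have JN v i : jacobiR (fun n => - a n) (fun n => - b n) v i = - jacobiR a b v i.
  by rewrite /jacobiR; case: i => [|i]; ring.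
suff : dotn n u (jacobiR (fun n => - a n) (fun n => - b n) u) <= - lm * dotn n u u.
  have -> : dotn n u (jacobiR (fun n => - a n) (fun n => - b n) u) = - dotn n u (jacobiR a b u).
    by rewrite /dotn -sumrN; apply: eq_bigr => i _; rewrite JN mulrN.
  by rewrite mulNr lerN2.
apply: (@jacobiR_form_le _ _ _ C) un => [k|k|c lmc]; rewrite ?normrN//.
have [|K HK] := @resolvent_bound _ a b (- c).
  by apply: res => /lmS; lra.
exists K => m v vm; apply: le_trans (HK _ _ vm) _.
rewrite le_eqVlt; apply/orP; left; apply/eqP; congr (_ * _).
by apply: eq_bigr => i _; rewrite JN; ring.
Qed.

(** * Locality of powers of Jacobi operators *)

Definition jacobiZR (R : realType) (a b : int -> R) (u : int -> R) : int -> R :=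
  fun n => a (n - 1) * u (n - 1) + b n * u n + a n * u (n + 1).

Definition jacobi_pow (R : realType) (a b : int -> R) (k : nat) (j : int) : int -> R :=
  iter k (jacobiZR a b) (fun i => (i == j)%:R).

Lemma jacobi_powS (R : realType) (a b : int -> R) (k : nat) (j i : int) :
  jacobi_pow a b k.+1 j i = a (i - 1) * jacobi_pow a b k j (i - 1)
    + b i * jacobi_pow a b k j i + a i * jacobi_pow a b k j (i + 1).
Proof. by []. Qed.

Lemma jacobi_pow_support (R : realType) (a b : int -> R) (k : nat) (j i : int) :
  k%:Z < `|i - j| -> jacobi_pow a b k j i = 0.
Proof.
elim: k i => [|k IH] i ki.
  by rewrite /jacobi_pow /=; case: eqP => // ij; move: ki; rewrite ij subrr.
by rewrite jacobi_powS !IH ?mulr0 ?addr0//; lia.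
Qed.

(** Paths of k steps from [j] meet only coefficients within distance k. In the induction, a
    coefficient not known to agree multiplies an entry that vanishes by [jacobi_pow_support]. *)
Lemma jacobi_pow_local (R : realType) (a b a' b' : int -> R) (s j : int) (k : nat) :
  (forall i : int, `|i - j| <= k%:Z -> a i = a' (i + s) /\ b i = b' (i + s)) ->
  forall i, jacobi_pow a b k j i = jacobi_pow a' b' k (j + s) (i + s).
Proof.
elim: k => [|k IH] ab i; first by rewrite /jacobi_pow /= (inj_eq (addIr s)).
have {}IH := IH (fun l lk => ab l ltac:(lia)).
have coef (l : int) (c c' : int -> R) : (`|l - j| <= k%:Z -> c i = c' (i + s)) ->
    c i * jacobi_pow a b k j l = c' (i + s) * jacobi_pow a b k j l.
  have [lk cc|kl _] := leP `|l - j| k%:Z; first by rewrite cc.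
  by rewrite jacobi_pow_support ?mulr0.
rewrite !jacobi_powS.
have -> : i + s - 1 = (i - 1) + s by ring.
have -> : i + s + 1 = (i + 1) + s by ring.
rewrite -!IH; congr (_ + _ + _).
- have [lk|kl] := leP `|i - 1 - j| k%:Z; last by rewrite jacobi_pow_support ?mulr0.
  by have [-> _] := ab (i - 1) ltac:(lia).
- by apply: coef => lk; have [_ ->] := ab i ltac:(lia).
- by apply: coef => lk; have [-> _] := ab i ltac:(lia).
Qed.

Lemma jacobi_pow_bound (R : realType) (a b : int -> R) (C : R) (k : nat) (j i : int) :
  (forall n, `|a n| <= C) -> (forall n, `|b n| <= C) ->
  `|jacobi_pow a b k j i| <= (3 * C) ^+ k.
Proof.
move=> aC bC; have C0 : 0 <= C by apply: le_trans (aC 0).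
elim: k i => [|k IH] i.
  by rewrite /jacobi_pow /= expr0; case: (_ == _); rewrite ?normr1 ?normr0.
rewrite jacobi_powS exprS.
have term (c : R) l : `|c| <= C -> `|c * jacobi_pow a b k j l| <= C * (3 * C) ^+ k.
  by move=> cC; rewrite normrM ler_pM.
apply: le_trans (ler_normD _ _) _; apply: le_trans (lerD (ler_normD _ _) (lexx _)) _.
have := term _ (i - 1) (aC (i - 1)); have := term _ i (bC i).
by have := term _ (i + 1) (aC i); lra.
Qed.

Lemma jacobiZ_real (R : realType) (a b : int -> R) (k : nat) (i : int) :
  iter k (jacobiZ a b) (delta R 0) i = (jacobi_pow a b k 0 i)%:C.
Proof.
elim: k i => [|k IH] i; first by rewrite /= /delta /jacobi_pow /= rmorph_nat.
by rewrite iterS /jacobiZ !IH jacobi_powS !rmorphD !rmorphM.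
Qed.

Definition extend0 (R : realType) (h : nat -> R) (z : int) : R :=
  if z is Posz i then h i else 0.

Definition cut (R : realType) (n : nat) (h : nat -> R) (i : nat) : R :=
  if (i < n)%N then h i else 0.

Lemma sum_delta (R : realType) (n k : nat) (h : nat -> R) :
  \sum_(l < n) ((l == k :> nat)%:R * h l) = cut n h k.
Proof.
rewrite /cut; case: ltnP => [kn|nk].
  rewrite (bigD1 (Ordinal kn))//= eqxx mul1r big1 ?addr0// => l lk.
  by rewrite -val_eqE /= in lk; rewrite (negbTE lk) mul0r.
by rewrite big1// => l _; rewrite ltn_eqF ?mul0r// (leq_trans _ nk).
Qed.

Lemma jacobi_mx_row (R : realType) (a b v : nat -> R) (n : nat) (i : 'I_n) :
  \sum_l jacobi_mx a b n i l * v l =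
    (if i : nat is m.+1 then a m * v m else 0) + b i * v i
      + (if (i.+1 < n)%N then a i * v i.+1 else 0).
Proof.
have -> : \sum_l jacobi_mx a b n i l * v l =
    \sum_(l < n) ((l.+1 == i)%:R * (a l * v l)) + \sum_(l < n) ((l == i :> nat)%:R * (b i * v l))
     + \sum_(l < n) ((l == i.+1 :> nat)%:R * (a i * v l)).
  rewrite -!big_split; apply: eq_bigr => l _ /=; rewrite mxE.
  have [->|il] := eqVneq (i : nat) l.
    by rewrite mul1r (gtn_eqF (ltnSn l)) (ltn_eqF (ltnSn l)) !mul0r addr0 add0r.
  rewrite mul0r addr0; have [->|_] := eqVneq (l : nat) i.+1.
    by rewrite mul1r gtn_eqF ?mul0r ?add0r// ltnW.
  by rewrite mul0r addr0; case: eqP; rewrite ?mul1r ?mul0r.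
rewrite (sum_delta n i (fun l => b i * v l)) (sum_delta n i.+1 (fun l => a i * v l)).
rewrite /cut ltn_ord; congr (_ + _ + _).
case: i => -[|m] /= mn; first by rewrite big1// => l _; rewrite mul0r.
under eq_bigr do rewrite eqSS.
by rewrite (sum_delta n m (fun l => a l * v l)) /cut ltnW.
Qed.

(** A truncation is a block of an operator on the whole line whose outer couplings vanish. The n
    sites have only n - 1 bonds between them, hence [n.-1] in the cut of [a]. *)
Lemma mxpow_jacobi (R : realType) (a b : nat -> R) (n k : nat) (i j : 'I_n) :
  mxpow (jacobi_mx a b n) k i j =
  jacobi_pow (extend0 (cut n.-1 a)) (extend0 (cut n b)) k j%:Z i%:Z.
Proof.
elim: k i => [|k IH] i; first by rewrite /mxpow /jacobi_pow /= mxE -val_eqE.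
rewrite jacobi_powS /mxpow iterS mxE -/(mxpow _ _).
under eq_bigr do rewrite IH.
rewrite (jacobi_mx_row _ _ (fun l => jacobi_pow _ _ k j%:Z l%:Z)).
congr (_ + _ + _).
- case: i => -[|m] mn /=; first by rewrite mul0r.
  have -> : m.+1%:Z - 1 = m%:Z by rewrite -addn1 PoszD addrK.
  rewrite /= subn1 /= /cut; have -> : (m < n.-1)%N by lia.
  by [].
- by rewrite /= /cut ltn_ord.
- have -> : i%:Z + 1 = i.+1%:Z by rewrite -addn1 PoszD.
  rewrite /= /cut; have -> : (i < n.-1)%N = (i.+1 < n)%N by lia.
  by case: ifP; rewrite ?mul0r.
Qed.

(** The diagonal entry is taken at site k because k steps from there stay within the sites 0, ...,
    2k. The left end is thus invisible, and only the forward orbit of a possibly non-invertible [T]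
    is used. *)
Definition site_pow (R : realType) (a b : nat -> R) (k : nat) : R :=
  jacobi_pow (extend0 a) (extend0 b) k k%:Z k%:Z.

Lemma mxpow_jacobi_site (R : realType) (a b : nat -> R) (n k p : nat) (i : 'I_n) :
  i = (p + k)%N :> nat -> ((p + k + k).+1 < n)%N ->
  mxpow (jacobi_mx a b n) k i i = site_pow (fun l => a (l + p)%N) (fun l => b (l + p)%N) k.
Proof.
move=> ip pn; rewrite mxpow_jacobi /site_pow ip PoszD addrC.
symmetry; apply: jacobi_pow_local => -[l|l] lk; last by exfalso; lia.
have lp1 : (l + p < n.-1)%N by lia.
have lp : (l + p < n)%N by lia.
by rewrite -PoszD /= /cut lp1 lp.
Qed.

Lemma site_pow_bound (R : realType) (a b : nat -> R) (C : R) (k : nat) :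
  (forall n, `|a n| <= C) -> (forall n, `|b n| <= C) ->
  `|site_pow a b k| <= (3 * C) ^+ k.
Proof.
move=> aC bC; have C0 : 0 <= C by apply: le_trans (aC 0%N).
by apply: jacobi_pow_bound => -[n|n] //=; rewrite normr0.
Qed.

(* The two sums agree, up to a shift by [k], except for at most [4 k + 2] terms. *)
Lemma trace_jacobi_pow (R : realType) (a b : nat -> R) (C : R) (n k : nat) :
  (forall n, `|a n| <= C) -> (forall n, `|b n| <= C) ->
  `|\tr (mxpow (jacobi_mx a b n) k) -
    \sum_(p < n) site_pow (fun l => a (l + p)%N) (fun l => b (l + p)%N) k| <=
  (4 * k + 2)%:R * (3 * C) ^+ k.
Proof.
move=> aC bC; have C0 : 0 <= C by apply: le_trans (aC 0%N).
pose y p := site_pow (fun l => a (l + p)%N) (fun l => b (l + p)%N) k.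
pose x i := jacobi_pow (extend0 (cut n.-1 a)) (extend0 (cut n b)) k (Posz i) (Posz i).
have B0 : 0 <= (3 * C) ^+ k by rewrite exprn_ge0// mulr_ge0.
have yB p : `|y p| <= (3 * C) ^+ k by apply: site_pow_bound.
have xB i : `|x i| <= (3 * C) ^+ k.
  by apply: jacobi_pow_bound => -[l|l] /=; rewrite ?normr0// /cut; case: ifP; rewrite ?normr0.
have xy p : ((p + k + k).+1 < n)%N -> x (p + k)%N = y p.
  move=> pn; have pk : (p + k < n)%N by lia.
  by rewrite /y -(@mxpow_jacobi_site _ a b n k p (Ordinal pk))// mxpow_jacobi.
have -> : \tr (mxpow (jacobi_mx a b n) k) = \sum_(i < n) x i.
  by apply: eq_bigr => i _; rewrite mxpow_jacobi.
have bound (z : nat -> R) (m s : nat) : (forall p, `|z p| <= (3 * C) ^+ k) ->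
    `|\sum_(i < m) z (s + i)%N| <= m%:R * (3 * C) ^+ k.
  move=> zB; apply: le_trans (ler_norm_sum _ _ _) _.
  apply: le_trans (ler_sum _ (fun i _ => zB _)) _.
  by rewrite sumr_const card_ord -[leLHS]mulr_natl.
(* In a short window all 2n <= 4k + 2 terms are bounded one by one. In a long one the interior terms
   cancel, leaving k + (k + 1) terms of the trace and 2k + 1 of the other sum. *)
have [nk|kn] := leqP n (k + k).+1.
  apply: le_trans (ler_normB _ _) _.
  have h1 := bound x n 0%N xB; have h2 := bound y n 0%N yB.
  apply: le_trans (lerD h1 h2) _; rewrite -mulrDl -natrD ler_wpM2r// ler_nat; lia.
have [m nE] : exists m, n = (k + m + k.+1)%N by exists (n - k - k.+1)%N; lia.
have -> : \sum_(i < n) x i = \sum_(i < k) x (0 + i)%N + \sum_(i < m) y i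
    + \sum_(i < k.+1) x (k + m + i)%N.
  rewrite nE !big_split_ord /=; congr (_ + _ + _).
  by apply: eq_bigr => i _; rewrite addnC xy//; have := ltn_ord i; lia.
have -> : \sum_(i < n) y i = \sum_(i < m) y i + \sum_(i < k + k.+1) y (m + i)%N.
  have -> : n = (m + (k + k.+1))%N by lia.
  by rewrite big_split_ord /=.
have h1 := bound x k 0%N xB; have h2 := bound x k.+1 (k + m)%N xB.
have h3 := bound y (k + k.+1)%N m yB.
set s1 := \sum_(i < k) x (0 + i)%N in h1 *; set s2 := \sum_(i < k.+1) x _ in h2 *.
set s3 := \sum_(i < k + k.+1) _ in h3 *; set s4 := \sum_(i < m) _.
have -> : s1 + s4 + s2 - (s4 + s3) = s1 + s2 - s3 by ring.
apply: le_trans (ler_normB _ _) _; apply: le_trans (lerD (ler_normD _ _) (lexx _)) _.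
have e1 : (4 * k + 2)%:R = 4 * k%:R + 2 :> R by rewrite natrD natrM.
have e2 : (k + k.+1)%:R = 2 * k%:R + 1 :> R by rewrite natrD -natr1; ring.
have e3 : k.+1%:R = k%:R + 1 :> R by rewrite natr1.
by move: h1 h2 h3; rewrite e1 e2 e3; lra.
Qed.

(** * Integrals along the orbit *)

Lemma integral_eq_law (R : realType) (d d' d'' : measure_display)
    (X : measurableType d) (X' : measurableType d') (Y : measurableType d'')
    (mu : {measure set X -> \bar R}) (mu' : {measure set X' -> \bar R})
    (phi : X -> Y) (phi' : X' -> Y) (h : Y -> R) :
  measurable_fun setT phi -> measurable_fun setT phi' -> measurable_fun setT h ->
  (forall B, measurable B -> mu' (phi' @^-1` B) = mu (phi @^-1` B)) ->
  mu.-integrable setT (EFin \o (h \o phi)) ->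
  mu'.-integrable setT (EFin \o (h \o phi')) ->
  (\int[mu']_x (h (phi' x))%:E = \int[mu]_x (h (phi x))%:E)%E.
Proof.
move=> mphi mphi' mh law i1 i2.
have mhE : measurable_fun setT (EFin \o h) by exact/measurable_EFinP.
have := @integral_pushforward _ _ _ _ _ _ mphi mu setT _ mhE.
rewrite preimage_setT => /(_ i1 measurableT) <-.
have := @integral_pushforward _ _ _ _ _ _ mphi' mu' setT _ mhE.
rewrite preimage_setT => /(_ i2 measurableT) <-.
by apply: eq_measure_integral => B mB _; exact: law.
Qed.

Section MeasurePreserving.
Variables (R : realType) (d : measure_display) (Omega : measurableType d).
Variables (mu : probability Omega R) (T : Omega -> Omega).
Hypothesis T_mp : measure_preserving mu T.

Lemma measurable_iter (n : nat) : measurable_fun setT (iter n T).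
Proof.
have [mT _] := T_mp; elim: n => [|n IH]; first exact: measurable_id.
exact: measurableT_comp.
Qed.

Lemma preimage_iter_measure (n : nat) (B : set Omega) :
  measurable B -> mu (iter n T @^-1` B) = mu B.
Proof.
have [mT TB] := T_mp; move=> mB; elim: n => [//|n IH].
rewrite -IH -(TB (iter n T @^-1` B)); last first.
  by rewrite -[X in measurable X]setTI; exact: measurable_iter.
by congr (mu _); apply/funext => w; rewrite /preimage /= -iterS iterSr.
Qed.

Lemma integral_iter (n : nat) (h : Omega -> R) (C : R) :
  measurable_fun setT h -> (forall w, `|h w| <= C) ->
  (\int[mu]_w (h (iter n T w))%:E = \int[mu]_w (h w)%:E)%E.
Proof.
move=> mh hC; have mn := measurable_iter n.
apply: (@integral_eq_law _ _ _ _ _ _ _ mu mu id (iter n T) h) => //.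
- by move=> B mB; exact: preimage_iter_measure.
- exact: (@probability_bounded_integrable _ _ _ _ (h \o id) C mh hC).
- apply: (@probability_bounded_integrable _ _ _ _ _ C); first exact: measurableT_comp.
  by move=> w; exact: hC.
Qed.

Lemma integrable_birkhoff (n : nat) (h : Omega -> R) (C : R) :
  measurable_fun setT h -> (forall w, `|h w| <= C) ->
  mu.-integrable setT (EFin \o (fun w => \sum_(i < n) h (iter i.+1 T w))).
Proof.
move=> mh hC; apply: (@probability_bounded_integrable _ _ _ _ _ (n%:R * C)).
  by apply: measurable_sum => i; apply: measurableT_comp (measurable_iter i.+1).
move=> w; apply: le_trans (ler_norm_sum _ _ _) _.
apply: le_trans (ler_sum _ (fun i _ => hC _)) _.
by rewrite sumr_const card_ord mulr_natl.
Qed.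

Lemma integral_birkhoff (n : nat) (h : Omega -> R) (C l : R) :
  measurable_fun setT h -> (forall w, `|h w| <= C) ->
  (\int[mu]_w (h w)%:E = l%:E)%E ->
  (\int[mu]_w (\sum_(i < n) h (iter i.+1 T w))%:E = (n%:R * l)%:E)%E.
Proof.
move=> mh hC hl; under eq_integral do rewrite -sumEFin.
rewrite integral_sum//; last first.
  move=> i; apply: (@probability_bounded_integrable _ _ _ _ _ C).
    exact: measurableT_comp (measurable_iter i.+1).
  by move=> w; exact: hC.
under eq_bigr do rewrite (integral_iter _ mh hC) hl.
by rewrite sumEFin sumr_const card_ord mulr_natl.
Qed.

End MeasurePreserving.

Lemma measurable_jacobi_pow (R : realType) (d : measure_display) (X : measurableType d)
    (al be : int -> X -> R) (k : nat) (j i : int) :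
  (forall n, measurable_fun setT (al n)) -> (forall n, measurable_fun setT (be n)) ->
  measurable_fun setT (fun w => jacobi_pow (al^~ w) (be^~ w) k j i).
Proof.
move=> mal mbe; elim: k i => [|k IH] i; first exact: measurable_cst.
under eq_fun do rewrite jacobi_powS.
by apply: measurable_funD; [apply: measurable_funD|]; exact: measurable_funM.
Qed.

Lemma measurable_norm_ge (R : realType) (c h : R) :
  measurable ([set x : R | h <= `|x - c|] : set (measurableTypeR R)).
Proof.
have mnorm : measurable_fun setT (fun x : measurableTypeR R => `|x - c|).
  by apply: measurableT_comp => //; apply: measurable_funB => //; exact: measurable_cst.
have -> : [set x : R | h <= `|x - c|] =
    setT `&` (fun x : measurableTypeR R => `|x - c|) @^-1` `[h, +oo[%classic.
  by rewrite setTI; apply/seteqP; split => x /=; rewrite in_itv /= andbT.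
exact: mnorm.
Qed.

(* Markov's inequality for the powers [(x - c) ^ (2 k)], as [k] tends to infinity. *)
Lemma concentration (R : realType) (nu : {measure set (measurableTypeR R) -> \bar R})
    (c h0 h : R) :
  0 <= h0 -> h0 < h ->
  (forall k, (\int[nu]_x ((x - c) ^+ (2 * k))%:E <= (h0 ^+ (2 * k))%:E)%E) ->
  nu [set x : R | h <= `|x - c|] = 0%E.
Proof.
move=> h00 h0h mom; set B := [set x | _].
have h_gt0 : 0 < h by exact: le_lt_trans h0h.
have msub : measurable_fun setT (fun x : measurableTypeR R => x - c : R).
  by apply: measurable_funB => //; exact: measurable_cst.
have mB : measurable B by exact: measurable_norm_ge.
have pow_ge0 (x : R) (k : nat) : 0 <= x ^+ (2 * k) by rewrite exprM exprn_ge0 ?sqr_ge0.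
have key k : ((h ^+ (2 * k))%:E * nu B <= (h0 ^+ (2 * k))%:E)%E.
  apply: le_trans (mom k).
  rewrite -(integral_cst nu mB (h ^+ (2 * k))%:E).
  have mpow : measurable_fun setT (fun x : measurableTypeR R => ((x - c) ^+ (2 * k))%:E).
    by apply/measurable_EFinP; exact: measurable_funX.
  apply: le_trans (_ : \int[nu]_(x in B) ((x - c) ^+ (2 * k))%:E <= _)%E.
    apply: ge0_le_integral => //.
    - by move=> x _; rewrite lee_fin.
    - exact: measurable_funS mpow.
    - move=> x Bx; rewrite lee_fin !exprM lerXn2r ?nnegrE ?sqr_ge0//.
      by rewrite -[leRHS]real_normK ?num_real// lerXn2r ?nnegrE// ltW.
  by apply: ge0_subset_integral => // x _; rewrite lee_fin.
pose q := (h0 / h) ^+ 2.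
have q0 : 0 <= q by exact: sqr_ge0.
have q1 : q < 1.
  have hh : 0 <= h0 / h by rewrite divr_ge0// ltW.
  by rewrite /q exprn_ilt1// ltr_pdivrMr// mul1r.
apply/eqP; rewrite eq_le measure_ge0 andbT; apply/lee_addgt0Pr => e e0; rewrite add0e.
have : q ^+ n @[n --> \oo] --> 0 by apply: cvg_expr; rewrite ger0_norm.
move=> /cvgrPdist_lt /(_ _ e0) [k _ /(_ k (leqnn _))].
rewrite sub0r normrN (ger0_norm (exprn_ge0 k q0)) => qk.
apply: le_trans (_ : (q ^+ k)%:E <= _)%E; last by rewrite lee_fin ltW.
have hk : 0 < h ^+ (2 * k) by rewrite exprn_gt0.
rewrite -(@lee_pmul2l _ (h ^+ (2 * k))%:E) ?lte_fin// -EFinM.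
suff -> : h ^+ (2 * k) * q ^+ k = h0 ^+ (2 * k) by exact: key.
by rewrite /q -exprM -exprMn mulrC divfK// lt0r_neq0.
Qed.

(** * The density of states *)

Section DensityOfStates.
Variables (R : realType) (d : measure_display) (Omega : measurableType d).
Variables (mu : probability Omega R) (T : Omega -> Omega) (f g : Omega -> R) (C : R).
Hypotheses (T_mp : measure_preserving mu T).
Hypotheses (f_meas : measurable_fun setT f) (g_meas : measurable_fun setT g).
Hypotheses (fC : forall w, `|f w| <= C) (gC : forall w, `|g w| <= C).

Definition site_moment (k : nat) (w : Omega) : R :=
  site_pow (fun l => f (iter l T w)) (fun l => g (iter l T w)) k.

Lemma site_moment_bound (k : nat) (w : Omega) : `|site_moment k w| <= (3 * C) ^+ k.
Proof. exact: site_pow_bound. Qed.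

Lemma measurable_site_moment (k : nat) : measurable_fun setT (site_moment k).
Proof.
apply: (@measurable_jacobi_pow _ _ _ (fun n w => extend0 (fun l => f (iter l T w)) n)
                                    (fun n w => extend0 (fun l => g (iter l T w)) n)) => -[l|l].
- by apply: measurableT_comp => //; exact: (measurable_iter T_mp).
- exact: measurable_cst.
- by apply: measurableT_comp => //; exact: (measurable_iter T_mp).
- exact: measurable_cst.
Qed.

Lemma integrable_site_moment (k : nat) : mu.-integrable setT (EFin \o site_moment k).
Proof.
apply: (@probability_bounded_integrable _ _ _ _ _ ((3 * C) ^+ k)).
  exact: measurable_site_moment.
exact: site_moment_bound.
Qed.

Definition dos_moment (k : nat) : R := fine (\int[mu]_w (site_moment k w)%:E).

Lemma dos_momentE (k : nat) : (\int[mu]_w (site_moment k w)%:E = (dos_moment k)%:E)%E.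
Proof. by rewrite fineK//; apply: integrable_fin_num => //; exact: integrable_site_moment. Qed.

(** Both integrands are the same function [h] of a window of 2k + 1 sites. The two-sided window
    starts at -k, so its site 0 is the entry k of the tuple, where [site_pow] takes the diagonal
    entry. *)
Lemma two_sided_moment (d' : measure_display) (Omega' : measurableType d')
    (mu' : probability Omega' R) (alpha beta : int -> Omega' -> R) (k : nat) :
  two_sided_version mu T f g mu' alpha beta ->
  (\int[mu']_w (jacobi_pow (alpha^~ w) (beta^~ w) k 0 0)%:E = (dos_moment k)%:E)%E.
Proof.
move=> [malpha mbeta [C' C'ab] law]; rewrite -dos_momentE.
pose n := (k + k).+1; pose RR := (measurableTypeR R * measurableTypeR R)%type.
pose phi (w : Omega) : n.-tuple RR := [tuple (f (iter i T w), g (iter i T w)) | i < n].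
pose phi' (w : Omega') : n.-tuple RR :=
  [tuple (alpha (i%:Z - k%:Z) w, beta (i%:Z - k%:Z) w) | i < n].
pose h (t : n.-tuple RR) : R :=
  site_pow (fun l => (nth (0, 0) t l).1) (fun l => (nth (0, 0) t l).2) k.
have window (i : int) : `|i - k%:Z| <= k%:Z -> exists2 l : nat, (l < n)%N & i = l%:Z.
  by case: i => l lk; [exists l => //; rewrite /n; lia|exfalso; lia].
have hphi w : h (phi w) = site_moment k w.
  rewrite /h /site_moment /site_pow -[k%:Z in RHS]addr0.
  apply: jacobi_pow_local => i /window[l ln ->].
  by rewrite addr0 /= -!(tnth_nth _ (phi w) (Ordinal ln)) /phi !tnth_mktuple.
have hphi' w : h (phi' w) = jacobi_pow (alpha^~ w) (beta^~ w) k 0 0.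
  rewrite /h /site_pow -[0 in RHS](subrr k%:Z).
  apply: jacobi_pow_local => i /window[l ln ->].
  by rewrite /= -!(tnth_nth _ (phi' w) (Ordinal ln)) /phi' !tnth_mktuple.
have mphi : measurable_fun setT phi.
  apply/measurable_fun_tnthP => i.
  rewrite (_ : _ \o _ = fun w => (f (iter i T w), g (iter i T w))); last first.
    by apply/funext => w /=; rewrite tnth_mktuple.
  by apply: measurable_fun_pair; apply: measurableT_comp => //; exact: (measurable_iter T_mp).
have mphi' : measurable_fun setT phi'.
  apply/measurable_fun_tnthP => i.
  rewrite (_ : _ \o _ = fun w => (alpha (i%:Z - k%:Z) w, beta (i%:Z - k%:Z) w)); last first.
    by apply/funext => w /=; rewrite tnth_mktuple.
  by apply: measurable_fun_pair; [exact: malpha|exact: mbeta].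
have mnth (l : nat) : measurable_fun setT (fun t : n.-tuple RR => nth (0, 0) t l).
  have [ln|nl] := ltnP l n.
    have -> : (fun t : n.-tuple RR => nth (0, 0) t l) = (fun t => tnth t (Ordinal ln)).
      by apply/funext => t; rewrite (tnth_nth (0, 0)).
    exact: measurable_tnth.
  have -> : (fun t : n.-tuple RR => nth (0, 0) t l) = (fun=> (0, 0)).
    by apply/funext => t; rewrite nth_default// size_tuple.
  exact: measurable_cst.
have mh : measurable_fun setT h.
  have mfst l : measurable_fun setT (fun t : n.-tuple RR => (nth (0, 0) t l).1).
    by apply: measurableT_comp (mnth l).
  have msnd l : measurable_fun setT (fun t : n.-tuple RR => (nth (0, 0) t l).2).
    by apply: measurableT_comp (mnth l).
  have mext (u : nat -> n.-tuple RR -> R) (z : int) :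
      (forall l, measurable_fun setT (u l)) -> measurable_fun setT (fun t => extend0 (u^~ t) z).
    by case: z => l mu_l; [exact: mu_l|exact: measurable_cst].
  exact: (measurable_jacobi_pow k k%:Z k%:Z (fun z => mext _ z mfst) (fun z => mext _ z msnd)).
transitivity (\int[mu']_w (h (phi' w))%:E)%E; first by apply: eq_integral => w _; rewrite hphi'.
transitivity (\int[mu]_w (h (phi w))%:E)%E; last by apply: eq_integral => w _; rewrite hphi.
apply: integral_eq_law => //.
- by move=> B mB; exact: law.
- apply: (@probability_bounded_integrable _ _ _ _ _ ((3 * C) ^+ k)).
    exact: measurableT_comp.
  by move=> w /=; rewrite hphi; exact: site_moment_bound.
- apply: (@probability_bounded_integrable _ _ _ _ _ ((3 * C') ^+ k)).
    exact: measurableT_comp.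
  move=> w /=; rewrite hphi'.
  by apply: jacobi_pow_bound => m; have [] := C'ab m w.
Qed.

(** The powers of x are unbounded, so the defining property of dN does not apply to them directly.
    The moments of every [m w] grow at most like (3 C')^k; hence all these measures, and [N] with
    them, vanish outside a fixed bounded set, and x^k can be truncated there. *)
Lemma density_of_states_moments (N : {measure set (measurableTypeR R) -> \bar R}) :
  density_of_states mu T f g N ->
  exists M : R,
    [/\ N [set x : R | M <= `|x|] = 0%E, N setT = 1%E &
        forall k, (\int[N]_x (x ^+ k)%:E = (dos_moment k)%:E)%E].
Proof.
move=> [d' [X' [mu' [alpha [beta [m [ts sp dos]]]]]]].
have [_ _ [C' C'ab] _] := ts.
have mom w k : (\int[m w]_x (x ^+ k)%:E = (jacobi_pow (alpha^~ w) (beta^~ w) k 0 0)%:E)%E.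
  by rewrite (sp w k) jacobiZ_real.
have powB w k : `|jacobi_pow (alpha^~ w) (beta^~ w) k 0 0| <= (3 * C') ^+ k.
  by apply: jacobi_pow_bound => n; have [] := C'ab n w.
pose M := 3 * `|C'| + 1.
pose B := [set x : R | M <= `|x|].
have BE : B = [set x : R | M <= `|x - 0|] by apply/seteqP; split=> x /=; rewrite subr0.
have mB : measurable (B : set (measurableTypeR R)) by rewrite BE; exact: measurable_norm_ge.
have mwB w : m w B = 0%E.
  rewrite BE; apply: (@concentration _ _ _ (3 * `|C'|)); first by rewrite mulr_ge0.
    by rewrite /M ltrDl.
  move=> k; have -> : (\int[m w]_x ((x - 0) ^+ (2 * k))%:E = \int[m w]_x (x ^+ (2 * k))%:E)%E.
    by apply: eq_integral => x _; rewrite subr0.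
  rewrite mom lee_fin; apply: le_trans (ler_norm _) _; apply: le_trans (powB _ _) _.
  apply: le_trans (ler_norm _) _; rewrite normrX normrM normr_nat//.
have mwT w : m w setT = 1%E.
  have := mom w 0%N; rewrite /jacobi_pow /= => <-.
  under eq_integral do rewrite expr0.
  by rewrite integral_cst// mul1e.
have NB : N B = 0%E.
  have bB : exists C0 : R, forall x, `|\1_B x| <= C0.
    by exists 1 => x; rewrite indicE; case: (_ \in _); rewrite ?normr1 ?normr0.
  have iB (nu : {measure set (measurableTypeR R) -> \bar R}) :
      (\int[nu]_x (\1_B x)%:E = nu B)%E by rewrite integral_indic ?setIT//; exact: mB.
  have := dos \1_B (measurable_indic mB) bB; rewrite iB => ->.
  by under eq_integral do rewrite iB mwB; rewrite integral0.
exists M; split=> //.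
- have b1 : exists C0 : R, forall x : R, `|cst 1 x| <= C0 by exists 1 => x; rewrite normr1.
  have := dos (cst 1) (measurable_cst _) b1.
  rewrite /= integral_cst// mul1e => ->.
  under eq_integral do rewrite integral_cst// mul1e mwT.
  by rewrite (integral_cst mu' measurableT 1%E) mul1e; exact: probability_setT.
- move=> k; rewrite -(two_sided_moment k ts).
  pose h x : R := \1_(~` B) x * x ^+ k.
  have mh : measurable_fun setT (h : measurableTypeR R -> R).
    apply: measurable_funM; first by apply: measurable_indic; exact: measurableC.
    exact: measurable_funX.
  have hE (nu : {measure set (measurableTypeR R) -> \bar R}) : nu B = 0%E ->
      (\int[nu]_x (x ^+ k)%:E = \int[nu]_x (h x)%:E)%E.
    move=> nuB; apply: (eq_integral_conull (measurableC mB)); first by rewrite setCK.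
    by move=> x nBx; rewrite /h indicE mem_set// mul1r.
  rewrite hE// dos//; first by apply: eq_integral => w _; rewrite -hE// mom.
  exists (M ^+ k) => x; rewrite /h indicE; case: (boolP (x \in ~` B)); last first.
    by rewrite mul0r normr0 exprn_ge0// addr_ge0// mulr_ge0.
  rewrite inE /B /= => /negP; rewrite -ltNge => xM.
  by rewrite mul1r normrX lerXn2r ?nnegrE// ?ltW// (le_lt_trans _ xM).
Qed.

End DensityOfStates.

(** * Truncations, their traces and polynomial moments *)

Section NumericalRange.
Variables (R : realType) (lm lM : R).

Definition numerical_range (a b : nat -> R) : Prop :=
  forall n u, supported n u ->
    lm * dotn n u u <= dotn n u (jacobiR a b u) <= lM * dotn n u u.

Lemma numerical_range_shift (a b : nat -> R) :
  numerical_range a b -> numerical_range (fun n => a n.+1) (fun n => b n.+1).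
Proof.
move=> ab n u un; pose v (i : nat) := if i is m.+1 then u m else 0.
have vn : supported n.+1 v by case=> [//|i]; rewrite ltnS => /un.
have dotv (y z : nat -> R) : (forall i, y i.+1 = z i) -> dotn n.+1 v y = dotn n u z.
  move=> yz; rewrite /dotn big_ord_recl /= mul0r add0r.
  by apply: eq_bigr => i _; rewrite /= yz.
have := ab _ _ vn; rewrite (dotv v u)// (dotv _ (jacobiR (fun n => a n.+1) (fun n => b n.+1) u))//.
by case=> [|i]; rewrite /jacobiR /= ?mulr0.
Qed.

(** The quadratic form of a truncation is that of the half-line operator at vectors extended by
    zero, so the truncation inherits the bounds [lm] and [lM]. *)
Lemma numerical_range_spectrum (a b : nat -> R) (n : nat) :
  numerical_range a b ->
  exists x : 'I_n -> R,
    [/\ forall i, lm <= x i <= lM,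
        forall E, jacobi_det (fun i => a i.+1) (fun i => b i.+1) n E = \prod_i (E - x i) &
        forall k, \tr (mxpow (jacobi_mx (fun i => a i.+1) (fun i => b i.+1) n) k) =
                  \sum_i x i ^+ k].
Proof.
move=> ab; apply: real_symmetric_spectrum.
  apply/matrixP => i j; rewrite !mxE [in LHS]eq_sym; case: eqVneq => [->//|_].
  case: eqP => [ij|_]; case: eqP => [ji|_] //; exfalso; lia.
move=> u; pose v k := if insub k is Some i then u i else 0.
have vE (i : 'I_n) : v i = u i by rewrite /v valK.
have vn : supported n v by move=> k nk; rewrite /v insubN// -leqNgt.
have := ab _ _ vn.
have -> : dotn n v v = \sum_i u i ^+ 2 by apply: eq_bigr => i _; rewrite vE expr2.
suff -> : dotn n v (jacobiR a b v) =
  \sum_i \sum_j u i * jacobi_mx (fun i => a i.+1) (fun i => b i.+1) n i j * u j by [].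
apply: eq_bigr => i _; rewrite vE.
have -> : \sum_j u i * jacobi_mx (fun i => a i.+1) (fun i => b i.+1) n i j * u j =
    u i * \sum_j jacobi_mx (fun i => a i.+1) (fun i => b i.+1) n i j * v j.
  by rewrite mulr_sumr; apply: eq_bigr => j _; rewrite vE mulrA.
rewrite jacobi_mx_row; congr (_ * (_ + _)).
  by case: (nat_of_ord i).
by case: ltnP => // /vn ->; rewrite mulr0.
Qed.

End NumericalRange.

Definition trace_poly (R : realType) (p : {poly R}) (n : nat) (J : 'M[R]_n) : R :=
  \sum_(k < size p) p`_k * \tr (mxpow J k).

Lemma trace_poly_spectrum (R : realType) (p : {poly R}) (n : nat) (J : 'M[R]_n) (x : 'I_n -> R) :
  (forall k, \tr (mxpow J k) = \sum_i x i ^+ k) -> trace_poly p J = \sum_i p.[x i].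
Proof.
move=> trJ; rewrite /trace_poly; under eq_bigr do rewrite trJ mulr_sumr.
by rewrite exchange_big; apply: eq_bigr => i _; rewrite horner_coef.
Qed.

Section PolynomialMoments.
Variables (R : realType) (d : measure_display) (Omega : measurableType d).
Variables (mu : probability Omega R) (T : Omega -> Omega) (f g : Omega -> R) (C : R).
Hypotheses (T_mp : measure_preserving mu T).
Hypotheses (f_meas : measurable_fun setT f) (g_meas : measurable_fun setT g).
Hypotheses (fC : forall w, `|f w| <= C) (gC : forall w, `|g w| <= C).
Local Notation dos_moment := (dos_moment mu T f g).
Local Notation site_moment := (site_moment T f g).

(** The integral of [p] against dN, written through the moments so that it is available as a linear
    functional before any measure on the line is involved. *)
Definition dos_poly (p : {poly R}) : R := \sum_(k < size p) p`_k * dos_moment k.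

Lemma dos_poly_widen (p : {poly R}) (n : nat) : (size p <= n)%N ->
  dos_poly p = \sum_(k < n) p`_k * dos_moment k.
Proof.
move=> pn; rewrite /dos_poly -(subnKC pn) big_split_ord /= [X in _ = _ + X]big1 ?addr0//.
by move=> i _; rewrite nth_default ?mul0r// leq_addr.
Qed.

Lemma dos_poly_is_linear : scalar dos_poly.
Proof.
move=> c p q; pose n := maxn (size p) (size q).
rewrite !(@dos_poly_widen _ n) ?leq_maxl ?leq_maxr//; last first.
  apply: leq_trans (size_polyD _ _) _.
  by rewrite geq_max leq_maxr (leq_trans (size_scale_leq _ _)) ?leq_maxl.
rewrite mulr_sumr -big_split; apply: eq_bigr => k _ /=.
by rewrite coefD coefZ mulrDl mulrA.
Qed.

Lemma dos_moment0 : dos_moment 0 = 1.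
Proof.
apply: EFin_inj; rewrite -(dos_momentE T_mp f_meas g_meas fC gC).
rewrite (_ : (fun w => _) = cst 1%E); last by apply/funext.
by rewrite (integral_cst mu measurableT 1%E) mul1e; exact: probability_setT.
Qed.

Lemma dos_polyC (c : R) : dos_poly c%:P = c.
Proof.
rewrite (@dos_poly_widen _ 1) ?size_polyC_leq1// big_ord1 coefC /= dos_moment0.
exact: mulr1.
Qed.

(** Different powers are read off at different sites, so pointwise this need not be a diagonal entry
    of p(J). Its mean is nevertheless right by stationarity, and its sums along the orbit differ
    from traces by boundary terms only. *)
Definition site_poly (p : {poly R}) (w : Omega) : R := \sum_(k < size p) p`_k * site_moment k w.

Definition poly_bound (p : {poly R}) : R := \sum_(k < size p) `|p`_k| * (3 * C) ^+ k.

Lemma site_poly_bound (p : {poly R}) (w : Omega) : `|site_poly p w| <= poly_bound p.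
Proof.
apply: le_trans (ler_norm_sum _ _ _) _; apply: ler_sum => k _.
by rewrite normrM ler_wpM2l//; exact: site_moment_bound.
Qed.

Lemma measurable_site_poly (p : {poly R}) : measurable_fun setT (site_poly p).
Proof.
apply: measurable_sum => k; apply: measurable_funM; first exact: measurable_cst.
exact: (measurable_site_moment T_mp).
Qed.

Lemma integral_site_poly (p : {poly R}) : (\int[mu]_w (site_poly p w)%:E = (dos_poly p)%:E)%E.
Proof.
have intk k : mu.-integrable setT (fun w => (p`_k * site_moment k w)%:E).
  under eq_fun do rewrite EFinM.
  by apply: integrableZl => //; exact: (integrable_site_moment T_mp f_meas g_meas fC gC).
rewrite /site_poly /dos_poly.
under eq_integral do rewrite -sumEFin.
rewrite integral_sum//.
rewrite -sumEFin; apply: eq_bigr => k _.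
under eq_integral do rewrite EFinM.
rewrite integralZl//; last exact: (integrable_site_moment T_mp f_meas g_meas fC gC).
by rewrite (dos_momentE T_mp f_meas g_meas fC gC) -EFinM.
Qed.

Definition window_mx (n : nat) (w : Omega) : 'M[R]_n :=
  jacobi_mx (fun i => f (iter i.+1 T w)) (fun i => g (iter i.+1 T w)) n.

Lemma trace_poly_window (p : {poly R}) :
  exists K : R, forall n w,
    `|trace_poly p (window_mx n w) - \sum_(i < n) site_poly p (iter i.+1 T w)| <= K.
Proof.
exists (\sum_(k < size p) `|p`_k| * ((4 * k + 2)%:R * (3 * C) ^+ k)) => n w.
rewrite /site_poly exchange_big /trace_poly -sumrB.
apply: le_trans (ler_norm_sum _ _ _) _; apply: ler_sum => k _.
rewrite -mulr_sumr -mulrBr normrM ler_wpM2l//.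
have := @trace_jacobi_pow R (fun i => f (iter i.+1 T w)) (fun i => g (iter i.+1 T w)) C n k
  (fun i => fC _) (fun i => gC _).
suff -> : \sum_(p0 < n) site_pow (fun l => f (iter (l + p0).+1 T w))
     (fun l => g (iter (l + p0).+1 T w)) k = \sum_(i < n) site_moment k (iter i.+1 T w) by [].
apply: eq_bigr => i _; congr (site_pow _ _ k); apply/funext => l;
  by rewrite -iterD addnS.
Qed.

Lemma integral_window_poly (p : {poly R}) (n : nat) :
  (\int[mu]_w (\sum_(i < n) site_poly p (iter i.+1 T w))%:E = (n%:R * dos_poly p)%:E)%E.
Proof.
exact: (integral_birkhoff T_mp n (measurable_site_poly p) (site_poly_bound p)
  (integral_site_poly p)).
Qed.

Variables (lm lM : R) (Bad : set Omega).
Hypotheses (mBad : measurable Bad) (Bad0 : mu Bad = 0%E).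
Hypothesis range : forall w, ~ Bad w ->
  numerical_range lm lM (fun n => f (iter n T w)) (fun n => g (iter n T w)).

(** [Bad] is not supposed to be invariant under [T], so the bound at [T w] is deduced from the one
    at [w] by prepending a zero to the test vectors. *)
Lemma range_shift (w : Omega) : ~ Bad w ->
  numerical_range lm lM (fun n => f (iter n T (T w))) (fun n => g (iter n T (T w))).
Proof.
move=> /range/numerical_range_shift; congr (numerical_range _ _ _ _);
  by apply/funext => n; rewrite iterSr.
Qed.

(** The trace of p over a window of n sites is nonnegative and has mean n * [dos_poly p] up to an
    error bounded by [K] for all n. A negative value would be contradicted by a large n. *)
Lemma dos_poly_ge0 (p : {poly R}) : (forall x, lm <= x <= lM -> 0 <= p.[x]) -> 0 <= dos_poly p.
Proof.
move=> p0; have [K HK] := trace_poly_window p.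
have key n : - K <= n%:R * dos_poly p.
  rewrite -lee_fin -integral_window_poly -[X in (X <= _)%E]mule1 -(@probability_setT _ _ _ mu).
  rewrite -(integral_cst mu measurableT (- K)%:E).
  apply: (le_integral_conull (measurableC mBad)); first by rewrite setCK.
  move=> w wBad; rewrite lee_fin.
  have [x [xI _ trx]] := numerical_range_spectrum n (range wBad).
  have : 0 <= trace_poly p (window_mx n w).
    by rewrite (trace_poly_spectrum _ trx) sumr_ge0// => i _; exact: p0.
  by have := HK n w; rewrite ler_norml => /andP[_]; lra.
rewrite leNgt; apply/negP => neg.
have neg' : 0 < - dos_poly p by rewrite oppr_gt0.
have := @archi_boundP R (`|K| / - dos_poly p).
rewrite divr_ge0// ?(ltW neg')// => /(_ isT); rewrite ltr_pdivrMr//.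
by have := key (Num.bound (`|K| / - dos_poly p)); have := ler_norm K; lra.
Qed.

End PolynomialMoments.

(** * An upper Thouless bound for the Lyapunov exponent *)

Section LyapunovBound.
Variables (R : realType) (d : measure_display) (Omega : measurableType d).
Variables (mu : probability Omega R) (T : Omega -> Omega) (f g : Omega -> R) (C : R).
Hypotheses (T_mp : measure_preserving mu T).
Hypotheses (f_meas : measurable_fun setT f) (g_meas : measurable_fun setT g).
Hypotheses (f_gt0 : forall w, 0 < f w) (C1 : 1 <= C).
Hypotheses (fC : forall w, `|f w| <= C) (gC : forall w, `|g w| <= C).
Hypothesis fVC : forall w, `|(f w)^-1| <= C.

Let C0 : 0 < C. Proof. exact: lt_le_trans C1. Qed.
Let f_le w : f w <= C. Proof. by rewrite -[leLHS]gtr0_norm. Qed.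
Let fV_le w : (f w)^-1 <= C. Proof. by rewrite -[leLHS]gtr0_norm ?invr_gt0. Qed.
Let f_ge w : C^-1 <= f w. Proof. by rewrite -[leRHS]invrK lef_pV2 ?posrE ?invr_gt0. Qed.

(** The determinant is at least C^(-2) and at most twice the square of the largest entry. The bound
    is uniform in n; it keeps the integrals of log norms away from -oo and the infimum defining the
    Lyapunov exponent bounded below. *)
Lemma opnorm_cocycle_ge (n : nat) (E : R) (w : Omega) :
  (2 * C)^-1 <= opnorm (cocycle T f g E%:C n w).
Proof.
rewrite cocycle_real; set M := cocycleR _ _ _ _ _ _; set s := opnorm _.
have Ms i j : `|M i j| <= s by exact: le_opnorm_real.
have s0 : 0 <= s by apply: le_trans (Ms 0 0).
have : \det M <= 2 * s ^+ 2.
  rewrite det_mx2; apply: le_trans (ler_norm _) _; apply: le_trans (ler_normB _ _) _.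
  rewrite !normrM expr2.
  have := ler_pM (normr_ge0 _) (normr_ge0 _) (Ms 0 0) (Ms 1 1).
  have := ler_pM (normr_ge0 _) (normr_ge0 _) (Ms 0 1) (Ms 1 0).
  lra.
rewrite (det_cocycleR T g f_gt0) => dets.
have : C^-1 * C^-1 <= f w / f (iter n T w).
  by rewrite ler_pM ?invr_ge0 ?(ltW C0)// lef_pV2 ?posrE.
move=> /le_trans/(_ dets) h.
rewrite -(@ler_pXn2r _ 2)// ?nnegrE ?invr_ge0 ?mulr_ge0 ?(ltW C0)//.
rewrite invfM exprMn [_^-1 ^+ 2 * _]mulrC.
have : 0 <= C^-1 ^+ 2 by exact: sqr_ge0.
rewrite -expr2 in h; lra.
Qed.

Lemma bond_prod_expR (n : nat) (w : Omega) :
  bond_prod T f n w = expR (\sum_(i < n) ln (f (iter i.+1 T w))).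
Proof. by rewrite expR_sum; apply: eq_bigr => i _; rewrite lnK ?posrE. Qed.

Variables (lm lM : R).

Lemma window_det_bound (p : {poly R}) (E : R) (n : nat) (w : Omega) :
  numerical_range lm lM (fun n => f (iter n T w)) (fun n => g (iter n T w)) ->
  (forall x, lm <= x <= lM -> `|E - x| <= expR p.[x]) ->
  `|window_det T f g n E w| <= expR (trace_poly p (window_mx T f g n w)).
Proof.
move=> /(numerical_range_spectrum n)[x [xI detx trx]] pE.
rewrite (trace_poly_spectrum _ trx) /window_det detx normr_prod expR_sum.
by apply: ler_prod => i _; rewrite normr_ge0 pE.
Qed.

Variable Bad : set Omega.
Hypotheses (mBad : measurable Bad) (Bad0 : mu Bad = 0%E).
Hypothesis range : forall w, ~ Bad w ->
  numerical_range lm lM (fun n => f (iter n T w)) (fun n => g (iter n T w)).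
Local Notation sp p := (site_poly T f g p).

(** The four entries involve the windows 1..n+2, 2..n+2, 1..n+1 and 2..n+1. Each misses at most one
    site at either end, which changes the sum of [site_poly] by at most 2B; the accompanying factors
    are at most C^2, whence 4 C^2. Starting at [n.+2] makes both rows fall under [cocycleR_row0]. *)
Lemma ln_opnorm_cocycle_le (p : {poly R}) :
  exists K : R, forall E n w, ~ Bad w ->
    (forall x, lm <= x <= lM -> `|E - x| <= expR p.[x]) ->
    ln (opnorm (cocycle T f g E%:C n.+2 w)) <=
    K + \sum_(i < n.+2) sp p (iter i.+1 T w) - \sum_(i < n.+2) ln (f (iter i.+1 T w)).
Proof.
have [K HK] := trace_poly_window T fC gC p.
pose B := poly_bound C p.
have spB w : `|sp p w| <= B by exact: site_poly_bound.
exists (ln (4 * C ^+ 2) + (K + 2 * B)) => E n w wBad pE.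
pose S m v := \sum_(i < m) sp p (iter i.+1 T v).
pose X := expR (K + 2 * B + S n.+2 w).
have detS m v : numerical_range lm lM (fun n => f (iter n T v)) (fun n => g (iter n T v)) ->
    `|window_det T f g m E v| <= expR (K + S m v).
  move=> rv; apply: le_trans (window_det_bound m rv pE) _; rewrite ler_expR.
  by have := HK m v; rewrite ler_norml => /andP[_]; rewrite -/(S m v); lra.
have B0 : 0 <= B by apply: le_trans (spB w).
have S1 : S n.+2 w = sp p (T w) + S n.+1 (T w).
  rewrite /S big_ord_recl; congr (_ + _); apply: eq_bigr => i _.
  by rewrite -iterSr.
have S2 m v : S m.+1 v = S m v + sp p (iter m.+1 T v) by rewrite /S big_ord_recr.
have bnd v : - B <= sp p v by have := spB v; rewrite ler_norml => /andP[].
have r0 := range wBad; have r1 := range_shift range wBad.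
have d1 : `|window_det T f g n.+2 E w| <= X.
  by apply: le_trans (detS _ _ r0) _; rewrite ler_expR; lra.
have d2 : `|window_det T f g n.+1 E (T w)| <= X.
  by apply: le_trans (detS _ _ r1) _; rewrite ler_expR S1; have := bnd (T w); lra.
have d3 : `|window_det T f g n.+1 E w| <= X.
  by apply: le_trans (detS _ _ r0) _; rewrite ler_expR (S2 n.+1); have := bnd (iter n.+2 T w); lra.
have d4 : `|window_det T f g n E (T w)| <= X.
  apply: le_trans (detS _ _ r1) _; rewrite ler_expR S1 S2.
  by have := bnd (T w); have := bnd (iter n.+1 T (T w)); lra.
pose P := bond_prod T f n.+2 w.
have P0 : 0 < P by exact: bond_prod_gt0.
have PS : (bond_prod T f n.+1 w)^-1 = f (iter n.+2 T w) / P.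
  by rewrite /P /bond_prod [in RHS]big_ord_recr invfM mulrCA divff ?mulr1// lt0r_neq0.
have [c00 c01] := cocycleR_row0 T g f_gt0 E n.+1 w.
have [c10 c11] := cocycleR_row0 T g f_gt0 E n w.
rewrite -(cocycleR_row1 T g f_gt0) in c10; rewrite -(cocycleR_row1 T g f_gt0) in c11.
have X0 : 0 < X by exact: expR_gt0.
have CXP : 0 < X / P by rewrite divr_gt0.
have CC : C <= C ^+ 2 by rewrite expr2 ler_peMl// ltW.
have entry (D c : R) : `|D| <= X -> 0 <= c <= C ^+ 2 -> `|c * D / P| <= C ^+ 2 * (X / P).
  move=> DX /andP[c0 cC].
  rewrite -mulrA normrM (ger0_norm c0) normrM [`|P^-1|]gtr0_norm ?invr_gt0//.
  have DXP : `|D| / P <= X / P by rewrite ler_pM2r ?invr_gt0.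
  by apply: ler_pM => //; rewrite divr_ge0// ltW.
have CI v : 0 <= f v <= C ^+ 2 by rewrite ltW//= (le_trans (f_le v)).
have CC1 : 0 <= f w * f (iter n.+2 T w) <= C ^+ 2.
  by rewrite mulr_ge0 ?(ltW (f_gt0 _))//= expr2 ler_pM// ltW.
have op_le : opnorm (cocycle T f g E%:C n.+2 w) <= 4 * C ^+ 2 * (X / P).
  rewrite cocycle_real; apply: le_trans (opnorm_real_le _) _.
  rewrite !big_ord_recl !big_ord0 !addr0.
  have -> : lift ord0 (ord0 : 'I_1) = 1 :> 'I_2 by apply/val_inj.
  rewrite c00 c01 c10 c11 PS.
  have e1 : `|1 * window_det T f g n.+2 E w / P| <= C ^+ 2 * (X / P).
    by apply: entry => //; rewrite ler01 (le_trans C1).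
  have e2 := entry _ _ d2 (CI w).
  have e3 := entry _ _ d3 (CI (iter n.+2 T w)).
  have e4 := entry _ _ d4 CC1.
  rewrite mul1r in e1.
  have -> : window_det T f g n.+1 E w * (f (iter n.+2 T w) / P) =
      f (iter n.+2 T w) * window_det T f g n.+1 E w / P by rewrite mulrCA mulrA.
  have -> : - f w * window_det T f g n E (T w) * (f (iter n.+2 T w) / P) =
      - (f w * f (iter n.+2 T w) * window_det T f g n E (T w) / P) by ring.
  rewrite normrN !mulNr normrN; lra.
have -> : ln (4 * C ^+ 2) + (K + 2 * B) + S n.+2 w - \sum_(i < n.+2) ln (f (iter i.+1 T w)) =
    ln (4 * C ^+ 2 * (X / P)).
  have C2 : 0 < 4 * C ^+ 2 by rewrite mulr_gt0// exprn_gt0.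
  rewrite [in RHS]lnM ?posrE// ln_div ?posrE// /X expRK /P bond_prod_expR expRK; ring.
rewrite ler_ln ?posrE//; last by rewrite mulr_gt0// mulr_gt0// exprn_gt0.
by apply: lt_le_trans (opnorm_cocycle_ge _ _ _); rewrite invr_gt0 mulr_gt0.
Qed.

Definition log_mean : R := fine (\int[mu]_w (ln (f w))%:E).

Lemma ln_f_bound (w : Omega) : `|ln (f w)| <= ln C.
Proof.
by rewrite ler_norml -lnV ?posrE// !ler_ln ?posrE ?invr_gt0// f_ge f_le.
Qed.

Lemma measurable_ln_f : measurable_fun setT (fun w => ln (f w)).
Proof. by apply: measurableT_comp => //; exact: measurable_ln. Qed.

Lemma log_meanE : (\int[mu]_w (ln (f w))%:E = log_mean%:E)%E.
Proof.
rewrite fineK//; apply: integrable_fin_num => //.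
by apply: (@probability_bounded_integrable _ _ _ _ _ (ln C));
  [exact: measurable_ln_f|exact: ln_f_bound].
Qed.

(** The exponent is an infimum over n, so it lies below the normalised integral at each n + 2; the
    boundary constant [K], divided by n + 2, becomes negligible. *)
Lemma lyapunov_le (p : {poly R}) (E : R) :
  (forall x, lm <= x <= lM -> `|E - x| <= expR p.[x]) ->
  lyapunov mu T f g E%:C <= dos_poly mu T f g p - log_mean.
Proof.
move=> pE; have [K HK] := ln_opnorm_cocycle_le p.
pose I n := (\int[mu]_w (ln (opnorm (cocycle T f g E%:C n w)))%:E)%E.
have cst_int (c : R) : (\int[mu]_w c%:E = c%:E)%E.
  by rewrite (integral_cst mu measurableT c%:E) [X in (_ * X)%E]probability_setT mule1.
have I_ge n : ((- ln (2 * C))%:E <= I n)%E.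
  rewrite -cst_int; apply: (le_integral_conull (measurableC mBad)); first by rewrite setCK.
  move=> w _; rewrite lee_fin -lnV ?posrE ?mulr_gt0// ler_ln ?posrE ?invr_gt0 ?mulr_gt0//.
    exact: opnorm_cocycle_ge.
  by apply: lt_le_trans (opnorm_cocycle_ge _ _ _); rewrite invr_gt0 mulr_gt0.
pose bound n := K + n.+2%:R * (dos_poly mu T f g p - log_mean).
have I_le n : (I n.+2 <= (bound n)%:E)%E.
  apply: le_trans (_ : \int[mu]_w (K + \sum_(i < n.+2) sp p (iter i.+1 T w)
      - \sum_(i < n.+2) ln (f (iter i.+1 T w)))%:E <= _)%E.
    apply: (le_integral_conull (measurableC mBad)); first by rewrite setCK.
    by move=> w wBad; rewrite lee_fin; exact: HK.
  have iS := integrable_birkhoff T_mp n.+2 (measurable_site_poly T_mp f_meas g_meas p)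
    (site_poly_bound T fC gC p).
  have iL := integrable_birkhoff T_mp n.+2 measurable_ln_f ln_f_bound.
  have iK : mu.-integrable setT (EFin \o cst K) by exact: finite_measure_integrable_cst.
  rewrite integralB_EFin//; last exact: (integrableD measurableT iK iS).
  rewrite integralD_EFin// cst_int (integral_window_poly T_mp f_meas g_meas fC gC).
  rewrite (integral_birkhoff T_mp n.+2 measurable_ln_f ln_f_bound log_meanE).
  by rewrite lee_fin /bound mulrBr addrA.
pose A := [set n%:R^-1 * (\int[mu]_w ln (opnorm (cocycle T f g E%:C n w)))%R
          | n in [set n : nat | (0 < n)%N]].
have lnC : 0 <= ln (2 * C) by apply: ln_ge0; move: C1; lra.
have A_lb : has_lbound A.
  exists (- ln (2 * C)) => _ [n /= n0 <-].
  have n1 : (n%:R^-1 : R) <= 1 by rewrite invf_le1 ?ltr0n// ler1n.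
  have n2 : (0 : R) <= n%:R^-1 by rewrite invr_ge0.
  (* The real-valued integral sends an infinite value to 0, which still respects the lower bound
     since ln (2 C) >= 0. *)
  have : - ln (2 * C) <= fine (I n).
    by have := I_ge n; case: (I n) => [r||] //=; rewrite ?lee_fin// oppr_le0.
  by rewrite /Rintegral -/(I n); nra.
have L_le n : lyapunov mu T f g E%:C <= n.+2%:R^-1 * bound n.
  apply: le_trans (_ : n.+2%:R^-1 * fine (I n.+2) <= _).
    by apply: ge_inf => //; exists n.+2.
  rewrite ler_pM2l ?invr_gt0//.
  have := I_le n; have := I_ge n.+2; case: (I n.+2) => [r||];
    rewrite ?lee_fin//= ?leeNy_eq ?leye_eq//.
rewrite leNgt; apply/negP; rewrite -subr_gt0; set x := _ - _ => x0.
have := @archi_boundP R (`|K| / x); set n := Num.bound _.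
rewrite divr_ge0 ?(ltW x0)// => /(_ isT); rewrite ltr_pdivrMr// => Kn.
have := L_le n; rewrite ler_pdivlMl// /bound => Ln.
have : n.+2%:R * x <= K.
  by rewrite /x mulrBr; lra.
have : n%:R * x <= n.+2%:R * x by rewrite ler_pM2r// ler_nat; lia.
have := ler_norm K; lra.
Qed.

End LyapunovBound.

(** * The geometric mean of the off-diagonal coefficients *)

Section LogMean.
Variables (R : realType) (d : measure_display) (Omega : measurableType d).
Variables (mu : probability Omega R) (T : Omega -> Omega) (f : Omega -> R) (C : R).
Hypotheses (T_mp : measure_preserving mu T) (f_meas : measurable_fun setT f).
Hypotheses (f_gt0 : forall w, 0 < f w) (C1 : 1 <= C).
Hypotheses (fC : forall w, `|f w| <= C) (fVC : forall w, `|(f w)^-1| <= C).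

Lemma geometric_mean_expR (n : nat) (w : Omega) :
  (\prod_(1 <= k < n.+1) f (iter k T w)) `^ (n%:R^-1) =
  expR (n%:R^-1 * \sum_(i < n) ln (f (iter i.+1 T w))).
Proof.
rewrite big_add1 big_mkord /= -/(bond_prod T f n w) /powR gt_eqF ?bond_prod_gt0//.
by rewrite (bond_prod_expR T f_gt0) expRK.
Qed.

(** The logarithms of the geometric means are bounded by ln C and converge almost everywhere to ln
    A. By invariance of [mu] their integrals equal [log_mean] for every n >= 1, so dominated
    convergence identifies it with ln A. *)
Lemma log_mean_limit (A : R) :
  {ae mu, forall w,
     (\prod_(1 <= k < n.+1) f (iter k T w)) `^ (n%:R^-1) @[n --> \oo] --> A} ->
  0 < A /\ log_mean mu f = ln A.
Proof.
move=> A_lim; pose h n w := n%:R^-1 * \sum_(i < n) ln (f (iter i.+1 T w)).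
have lnf w := @ln_f_bound R d Omega f C f_gt0 C1 fC fVC w.
have lnC0 : 0 <= ln C by apply: ln_ge0.
have h_bound n w : `|h n w| <= ln C.
  rewrite /h normrM ger0_norm ?invr_ge0//.
  have [->|n0] := posnP n; first by rewrite invr0 mul0r.
  rewrite ler_pdivrMl ?ltr0n//; apply: le_trans (ler_norm_sum _ _ _) _.
  apply: le_trans (ler_sum _ (fun i _ => lnf _)) _.
  by rewrite sumr_const card_ord mulr_natl.
have limE w : (\prod_(1 <= k < n.+1) f (iter k T w)) `^ (n%:R^-1) @[n --> \oo] --> A ->
    expR (h n w) @[n --> \oo] --> A.
  by under eq_fun do rewrite geometric_mean_expR.
have A0 w : expR (h n w) @[n --> \oo] --> A -> 0 < A.
  move=> hA; apply: lt_le_trans (expR_gt0 (- ln C)) _.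
  apply: (cvgr_to_ge hA); apply: nearW => n; rewrite ler_expR.
  by have := h_bound n w; rewrite ler_norml => /andP[].
have Apos : 0 < A.
  have [B [mB B0 sub]] := A_lim.
  have [w wB] : exists w, ~ B w.
    apply: contrapT => /forallNP nB.
    have BT : B = setT by apply/seteqP; split => w // _; apply: contrapT; exact: nB.
    have := @probability_setT _ _ _ mu; rewrite -BT B0 => /eqP.
    by rewrite eq_sym onee_eq0.
  by apply: (A0 w); apply: limE; apply: contrapT => nA; exact/wB/sub.
split=> //.
have mh n : measurable_fun setT (fun w => (h n w)%:E).
  apply/measurable_EFinP; apply: measurable_funM; first exact: measurable_cst.
  apply: measurable_sum => i; apply: (measurableT_comp (measurable_ln_f f_meas)).
  exact: (measurable_iter T_mp).
have mu_cst (c : R) : mu.-integrable setT (cst c%:E) by exact: finite_measure_integrable_cst.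
have [_ _ dom] : [/\ mu.-integrable setT (cst (ln A)%:E : Omega -> \bar R),
   [sequence (\int[mu]_(w in setT) `|(h n w)%:E - (ln A)%:E|)%E]_n @ \oo --> 0%E &
   [sequence (\int[mu]_(w in setT) (h n w)%:E)%E]_n @ \oo -->
     (\int[mu]_(w in setT) (ln A)%:E)%E].
  apply: (@dominated_convergence _ _ _ mu setT measurableT (fun n w => (h n w)%:E)
           (cst (ln A)%:E) (cst (ln C)%:E)) => //.
    apply: filterS A_lim => w /limE hA _.
    apply: cvg_EFin; first exact: nearW.
    rewrite (_ : fine \o _ = @ln R \o (fun n => expR (h n w))).
      by apply: cvg_comp hA _; exact: continuous_ln.
    by apply/funext => n /=; rewrite expRK.
  by apply: aeW => w n _; rewrite lee_fin.
rewrite (integral_cst mu measurableT (ln A)%:E) in dom.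
rewrite [X in (_ * X)%E]probability_setT mule1 in dom.
apply: EFin_inj; apply: (cvg_unique _ _ dom) => //.
apply: cvg_near_cst; near=> n.
have n0 : (0 < n)%N by near: n; exact: nbhs_infty_gt.
rewrite /= /h; under eq_integral do rewrite EFinM.
rewrite integralZl//; last exact: (integrable_birkhoff T_mp n (measurable_ln_f f_meas) lnf).
rewrite (integral_birkhoff T_mp n (measurable_ln_f f_meas) lnf
  (log_meanE mu f_meas f_gt0 C1 fC fVC)).
by rewrite -EFinM mulKf// pnatr_eq0 -lt0n.
Unshelve. all: by end_near.
Qed.

End LogMean.

(** * The lower bounds for the width of the spectrum *)

Lemma lne_le (R : realType) (x r : R) : 0 <= x -> x <= expR r -> (lne x%:E <= r%:E)%E.
Proof.
move=> x0 xr; rewrite -lee_expeR; have /eqP -> : expeR (lne x%:E) == x%:E.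
  by rewrite lneK_eq lee_fin.
by rewrite lee_fin.
Qed.

Section PolynomialIntegral.
Variables (R : realType) (N : {measure set (measurableTypeR R) -> \bar R}).
Variables (M : R) (mom : nat -> R).
Hypotheses (N_out : N [set x : R | M <= `|x|] = 0%E) (N_total : N setT = 1%E).
Hypothesis N_mom : forall k, (\int[N]_x (x ^+ k)%:E = (mom k)%:E)%E.

Lemma integral_poly (p : {poly R}) :
  (\int[N]_x (p.[x])%:E = (\sum_(k < size p) p`_k * mom k)%:E)%E.
Proof.
have NT : (N setT < +oo)%E by rewrite N_total ltry.
have mB : measurable ([set x : R | M <= `|x|] : set (measurableTypeR R)).
  rewrite (_ : [set x | _] = [set x : R | M <= `|x - 0|]); first exact: measurable_norm_ge.
  by apply/seteqP; split=> x /=; rewrite subr0.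
have intX k : N.-integrable setT (fun x : measurableTypeR R => (x ^+ k)%:E).
  apply: (@bounded_integrable _ _ _ N (fun x => x ^+ k) _ (`|M| ^+ k) NT (measurableC mB)).
  - by rewrite setCK.
  - exact: measurable_funX.
  - move=> x /= /negP; rewrite -ltNge normrX => xM.
    by rewrite lerXn2r ?nnegrE// ltW// (lt_le_trans xM)// ler_norm.
under eq_integral do rewrite horner_coef -sumEFin.
rewrite integral_sum//; last first.
  by move=> k; under eq_fun do rewrite EFinM; exact: integrableZl.
rewrite -sumEFin; apply: eq_bigr => k _.
under eq_integral do rewrite EFinM.
by rewrite integralZl// N_mom -EFinM.
Qed.

End PolynomialIntegral.

(** Positivity is applied to h0^(2k) - (x - c)^(2k), which is nonnegative on the interval with
    centre c and half-width h0. It bounds every even central moment as [concentration] requires. *)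
Lemma dos_concentration (R : realType) (d : measure_display) (Omega : measurableType d)
    (mu : probability Omega R) (T : Omega -> Omega) (f g : Omega -> R) (C lm lM : R)
    (N : {measure set (measurableTypeR R) -> \bar R}) (Bad : set Omega) :
  measure_preserving mu T -> measurable_fun setT f -> measurable_fun setT g ->
  (forall w, `|f w| <= C) -> (forall w, `|g w| <= C) ->
  measurable Bad -> mu Bad = 0%E ->
  (forall w, ~ Bad w ->
     numerical_range lm lM (fun n => f (iter n T w)) (fun n => g (iter n T w))) ->
  (forall p : {poly R}, (\int[N]_x (p.[x])%:E = (dos_poly mu T f g p)%:E)%E) ->
  lm <= lM ->
  forall h, (lM - lm) / 2 < h -> N [set x : R | h <= `|x - (lm + lM) / 2|] = 0%E.
Proof.
move=> Tmp mf mg fC gC mBad Bad0 range Npoly lmM h h_gt.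
apply: (concentration (h0 := (lM - lm) / 2)) => //; first by rewrite divr_ge0// subr_ge0.
move=> k; set c := (lm + lM) / 2; set h0 := (lM - lm) / 2.
pose p : {poly R} := ('X - c%:P) ^+ (2 * k).
have pE x : p.[x] = (x - c) ^+ (2 * k) by rewrite horner_exp hornerXsubC.
under eq_integral do rewrite -pE.
rewrite Npoly lee_fin -subr_ge0.
have -> : h0 ^+ (2 * k) - dos_poly mu T f g p = dos_poly mu T f g (- 1 *: p + (h0 ^+ (2 * k))%:P).
  by rewrite dos_poly_is_linear (dos_polyC Tmp mf mg fC gC) addrC mulN1r.
apply: (dos_poly_ge0 Tmp mf mg fC gC mBad Bad0 range) => x /andP[xm xM].
rewrite hornerD hornerZ hornerC pE mulN1r addrC subr_ge0 !exprM.
rewrite lerXn2r ?nnegrE ?sqr_ge0//.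
rewrite -[leLHS]real_normK ?num_real// lerXn2r ?nnegrE ?divr_ge0 ?subr_ge0//.
by rewrite ler_norml /h0 /c; lra.
Qed.

(* [tau q] is [ln (h / 2) + e] minus the nonnegative [\sum_i gam i * tau (t i) ^+ 2]. *)
Lemma log_kernel_functional (R : realType) (tau : {poly R} -> R) (c h e : R) :
  scalar tau -> (forall a, tau a%:P = a) -> 0 < h -> 0 < e ->
  exists (p : R -> {poly R}) (q : {poly R}),
    [/\ forall E x, `|E - c| <= h -> `|x - c| <= h -> `|E - x| <= expR (p E).[x],
        forall E, tau (p E) = q.[E] & tau q <= ln (h / 2) + e].
Proof.
move=> tau_lin tauC h0 e0.
have [n [gam [t [gam0 tE]]]] := log_kernel_bound c h0 e0.
pose k0 := ln (h / 2) + e.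
have tau_comb (m : nat) (a : nat -> R) :
    tau (k0%:P - \sum_(i < m) a i *: t i) = k0 - \sum_(i < m) a i * tau (t i).
  elim: m => [|m IH]; first by rewrite !big_ord0 !subr0 tauC.
  rewrite !big_ord_recr /= !opprD !addrA -IH [X in tau X]addrC -scaleNr tau_lin.
  by rewrite mulNr addrC.
exists (fun E => k0%:P - \sum_(i < n) (gam i * (t i).[E]) *: t i).
exists (k0%:P - \sum_(i < n) (gam i * tau (t i)) *: t i); split.
- move=> E x EI xI; apply: le_trans (tE _ _ EI xI) _.
  rewrite -{1}[h / 2]lnK ?posrE ?divr_gt0// -expRD ler_expR.
  rewrite hornerD hornerN hornerC horner_sum /k0 -addrA.
  rewrite le_eqVlt; apply/orP; left; apply/eqP; congr (_ + (_ - _)).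
  by apply: eq_bigr => i _; rewrite hornerZ mulrA.
- move=> E; rewrite (tau_comb n (fun i => gam i * (t i).[E])).
  rewrite hornerD hornerN hornerC horner_sum; congr (_ - _).
  by apply: eq_bigr => i _; rewrite hornerZ mulrAC.
- rewrite (tau_comb n (fun i => gam i * tau (t i))) gerBl sumr_ge0// => i _.
  by rewrite -mulrA mulr_ge0// -expr2 sqr_ge0.
Qed.

Lemma log_energy_ge (R : realType) (N : {measure set (measurableTypeR R) -> \bar R})
    (tau : {poly R} -> R) (c h : R) (p : R -> {poly R}) (q : {poly R}) :
  (forall s : {poly R}, (\int[N]_x (s.[x])%:E = (tau s)%:E)%E) -> scalar tau ->
  N [set x : R | h <= `|x - c|] = 0%E ->
  (forall E x, `|E - c| <= h -> `|x - c| <= h -> `|E - x| <= expR (p E).[x]) ->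
  (forall E, tau (p E) = q.[E]) ->
  (- log_energy N <= (tau q)%:E)%E.
Proof.
move=> Ntau tau_lin N0 pE tauq.
have mS := measurableC (measurable_norm_ge c h).
have NS : N (~` ~` [set x : R | h <= `|x - c|]) = 0%E by rewrite setCK.
have Sle (x : R) : (~` [set x : R | h <= `|x - c|]) x -> `|x - c| <= h.
  by move=> /= /negP; rewrite -ltNge => /ltW.
have NtauN (s : {poly R}) : (\int[N]_x (- s.[x])%:E = (- tau s)%:E)%E.
  have tau0 : tau 0 = 0.
    by have := tau_lin (-1) 0 0; rewrite scaler0 addr0 mulN1r addNr.
  have -> : - tau s = tau (-1 *: s + 0) by rewrite tau_lin tau0 addr0 mulN1r.
  rewrite -Ntau; apply: eq_integral => x _.
  by rewrite addr0 hornerZ mulN1r.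
rewrite leeNl -EFinN -NtauN /log_energy.
apply: (le_integral_conull mS NS) => x Sx; rewrite -tauq -NtauN.
apply: (le_integral_conull mS NS) => y Sy.
by rewrite EFinN leeN2; apply: lne_le => //; apply: pE; exact: Sle.
Qed.

Lemma le_of_perturbation (R : realType) (X : \bar R) (l : R) : 0 <= l ->
  (forall eta, 0 < eta -> (X <= ((l + 2 * eta) * (1 + eta))%:E)%E) -> (X <= l%:E)%E.
Proof.
move=> l0 H; apply/lee_addgt0Pr => e e0.
(* (l + 2 eta)(1 + eta) = l + eta (l + 2 + 2 eta), and the last factor is at most l + 4 when eta <=
   1. *)
pose eta := Num.min 1 (e / (l + 4)).
have l4 : 0 < l + 4 by lra.
have eta0 : 0 < eta by rewrite lt_min ltr01 divr_gt0.
have eta1 : eta <= 1 by rewrite ge_min lexx.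
have etae : eta * (l + 4) <= e by rewrite -ler_pdivlMr// ge_min lexx orbT.
apply: le_trans (H _ eta0) _; rewrite -EFinD lee_fin; nra.
Qed.

Theorem theorem3p5 (R : realType) (d : measure_display)
  (Omega : measurableType d) (mu : probability Omega R)
  (T : Omega -> Omega) (f g : Omega -> R)
  (T_ergodic : ergodic mu T)
  (f_meas : measurable_fun setT f) (g_meas : measurable_fun setT g)
  (f_gt0 : forall w, 0 < f w)
  (f_bounded : exists C : R, forall w, `|f w| <= C)
  (fV_bounded : exists C : R, forall w, `|(f w)^-1| <= C)
  (g_bounded : exists C : R, forall w, `|g w| <= C)
  (Sigma : set R)
  (Sigma_spectrum : {ae mu, forall w,
     spectrum (ergodic_jacobi T f g w) = [set x%:C | x in Sigma]})
  (lambda_m lambda_M : R)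
  (lambda_m_min : Sigma lambda_m /\ forall x, Sigma x -> lambda_m <= x)
  (lambda_M_max : Sigma lambda_M /\ forall x, Sigma x -> x <= lambda_M)
  (N : {measure set (measurableTypeR R) -> \bar R})
  (N_dos : density_of_states mu T f g N)
  (A : R)
  (A_lim : {ae mu, forall w,
     (\prod_(1 <= k < n.+1) f (iter k T w)) `^ (n%:R^-1) @[n --> \oo] --> A}) :
  (4%:E * expeR (- log_energy N) <= (lambda_M - lambda_m)%:E)%E /\
  ((4 * A)%:E * expeR (\int[N]_E (lyapunov mu T f g E%:C)%:E)
     <= (lambda_M - lambda_m)%:E)%E.
Proof.
have [T_mp _] := T_ergodic.
have [C1 fC1] := f_bounded; have [C2 fC2] := fV_bounded; have [C3 gC3] := g_bounded.
pose C := 1 + `|C1| + `|C2| + `|C3|.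
have C_ge1 : 1 <= C by rewrite /C -!addrA lerDl !addr_ge0.
have fC w : `|f w| <= C.
  apply: le_trans (fC1 w) _; apply: le_trans (ler_norm _) _; rewrite /C.
  by have := normr_ge0 C2; have := normr_ge0 C3; lra.
have fVC w : `|(f w)^-1| <= C.
  apply: le_trans (fC2 w) _; apply: le_trans (ler_norm _) _; rewrite /C.
  by have := normr_ge0 C1; have := normr_ge0 C3; lra.
have gC w : `|g w| <= C.
  apply: le_trans (gC3 w) _; apply: le_trans (ler_norm _) _; rewrite /C.
  by have := normr_ge0 C1; have := normr_ge0 C2; lra.
have [Bad [mBad Bad0 spBad]] := Sigma_spectrum.
have [Slm lm_le] := lambda_m_min; have [SlM lM_ge] := lambda_M_max.
have range w : ~ Bad w -> numerical_range lambda_m lambda_M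
    (fun n => f (iter n T w)) (fun n => g (iter n T w)).
  move=> wBad; have spw : spectrum (ergodic_jacobi T f g w) = [set x%:C | x in Sigma].
    by apply: contrapT => nsp; exact/wBad/spBad.
  exact: (jacobi_form_spectrum (fun n => fC _) (fun n => gC _) spw lm_le lM_ge).
have lm_lM : lambda_m <= lambda_M by exact: lM_ge.
have [M [N_out N_total N_mom]] := density_of_states_moments T_mp f_meas g_meas fC gC N_dos.
pose tau := dos_poly mu T f g.
have N_poly (p : {poly R}) : (\int[N]_x (p.[x])%:E = (tau p)%:E)%E.
  exact: (integral_poly N_out N_total N_mom).
have tau_lin : scalar tau by exact: dos_poly_is_linear.
have tauC a : tau a%:P = a by exact: (dos_polyC T_mp f_meas g_meas fC gC).
have [A0 lnA] := log_mean_limit T_mp f_meas f_gt0 C_ge1 fC fVC A_lim.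
have kernel eta : 0 < eta -> exists q : {poly R},
    [/\ 4 * expR (tau q) <= (lambda_M - lambda_m + 2 * eta) * (1 + eta),
        (- log_energy N <= (tau q)%:E)%E &
        (\int[N]_E (lyapunov mu T f g E%:C)%:E <= (tau q - ln A)%:E)%E].
  move=> eta0; pose h := (lambda_M - lambda_m) / 2 + eta; pose c := (lambda_m + lambda_M) / 2.
  have h0 : 0 < h by rewrite /h; lra.
  (* The error allowed in the kernel is ln (1 + eta), which becomes the factor 1 + eta after
     exponentiation; then 4 (h / 2) = 2 h is the length of the enlarged interval. *)
  have e0 : 0 < ln (1 + eta) by rewrite ln_gt0// ltrDl.
  have [p [q [pE tauq tauq_le]]] := log_kernel_functional c tau_lin tauC h0 e0.
  have N0 : N [set x : R | h <= `|x - c|] = 0%E.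
    apply: (dos_concentration T_mp f_meas g_meas fC gC mBad Bad0 range N_poly lm_lM).
    by rewrite /h ltrDl.
  exists q; split.
  - apply: le_trans (_ : 4 * expR (ln (h / 2) + ln (1 + eta)) <= _).
      by rewrite ler_pM2l// ler_expR.
    have eta1 : 0 < 1 + eta by lra.
    have h2 : 0 < h / 2 by rewrite divr_gt0.
    rewrite expRD !lnK ?posrE//.
    suff -> : 4 * (h / 2 * (1 + eta)) = (lambda_M - lambda_m + 2 * eta) * (1 + eta) by [].
    by rewrite /h; field.
  - exact: (log_energy_ge N_poly tau_lin N0 pE tauq).
  - have <- : (\int[N]_E ((q - (ln A)%:P).[E])%:E = (tau q - ln A)%:E)%E.
      rewrite N_poly; congr (_%:E).
      by rewrite [q - _]addrC -[- (ln A)%:P]scaleN1r tau_lin tauC mulN1r addrC.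
    (* The pointwise bound on the exponent is used only for E within h of c, which is almost every E
       for [N]. *)
    apply: (le_integral_conull (measurableC (measurable_norm_ge c h))); first by rewrite setCK.
    move=> E /= /negP; rewrite -ltNge => /ltW EI.
    rewrite lee_fin hornerD hornerN hornerC -tauq -lnA.
    apply: (lyapunov_le T_mp f_meas g_meas f_gt0 C_ge1 fC gC fVC mBad Bad0 range) => x /andP[xm xM].
    by apply: pE => //; rewrite ler_norml /c /h; lra.
have l0 : 0 <= lambda_M - lambda_m by rewrite subr_ge0.
split; apply: (le_of_perturbation l0) => eta /kernel[q [q_le I_le L_le]].
- apply: le_trans (_ : 4%:E * expeR (tau q)%:E <= _)%E.
    by rewrite lee_pmul2l ?lte_fin// lee_expeR.
  by rewrite -EFinM lee_fin.
- apply: le_trans (_ : (4 * A)%:E * expeR (tau q - ln A)%:E <= _)%E.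
    by rewrite lee_pmul2l ?lte_fin ?mulr_gt0// lee_expeR.
  rewrite -EFinM lee_fin expRD expRN lnK ?posrE//.
  by rewrite mulrAC -mulrA divfK ?lt0r_neq0.
Qed.
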